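(* There exist a map $(Q,\boldsymbol{\kappa})\mapsto \mathsf{A}(Q,\boldsymbol{\kappa})\in\mathbb{R}^{4\times4}$, defined for all quadrilaterals $Q$ (with ordered vertices $V_1,V_2,V_3,V_4$) and all constant symmetric positive-definite $2\times2$ matrices $\boldsymbol{\kappa}$, and a map $Q\mapsto \mathsf{B}(Q)\in\mathbb{R}^{4\times 4}$, defined for all such quadrilaterals $Q$, such that: (i) for every quadrilateral $Q$ (convex or nonconvex), every constant symmetric positive-definite $2\times2$ matrix $\boldsymbol{\kappa}$, and every set of generalized barycentric coordinates $\{\varphi_i\}_{i=1}^4$ on $Q$, the element stiffness matrix $$\mathsf{K}_{ij}:=\int_Q \boldsymbol{\kappa}\nabla\varphi_j\cdot\nabla\varphi_i\,d\boldsymbol{x},\qquad i,j=1,\dots,4,$$ satisfies $$\mathsf{K}=\mathsf{A}(Q,\boldsymbol{\kappa})+\tau\,\mathsf{B}(Q),$$ where $$\tau:=\int_Q\boldsymbol{\kappa}\nabla\Psi_h\cdot\nabla\Psi_h\,d\boldsymbol{x},\qquad \Psi_h:=\tfrac12\left(-\varphi_1+\varphi_2-\varphi_3+\varphi_4\right),$$ i.e. $\tau$ is the energy of the function $\Psi_h\in\mathrm{span}\{\varphi_1,\dots,\varphi_4\}$ whose value at the vertex $V_i$ is $(-1)^i/2$ (so $\tau$ is the only term in the decomposition that depends on the explicit form of the basis functions); (ii) $\mathsf{B}(Q)$ is the same matrix for all parallelograms $Q$.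
   Context: A quadrilateral $Q\subset\mathbb{R}^2$ is a (nondegenerate, simple, convex or nonconvex) closed quadrilateral of positive area, with vertices $V_i=(x_i,y_i)$, $i=1,2,3,4$, listed consecutively in counterclockwise order along the boundary. A set of generalized barycentric coordinates on $Q$ is a family of functions $\varphi_1,\dots,\varphi_4\in H^1(Q)\cap C^0(Q)$ such that $\varphi_i(V_j)=\delta_{ij}$, each $\varphi_i$ is affine on each edge of $Q$, and on $Q$ $$\sum_{i=1}^4\varphi_i=1,\qquad \sum_{i=1}^4x_i\varphi_i=x,\qquad \sum_{i=1}^4y_i\varphi_i=y.$$ (Examples: isoparametric bilinear finite element, harmonic, Wachspress, and mean value coordinates, where these are defined.) The matrix $\mathsf{A}$ depending only on the geometry of $Q$ and on $\boldsymbol{\kappa}$, and $\mathsf{B}$ depending only on the geometry of $Q$, is expressed by $\mathsf{A}$ and $\mathsf{B}$ being functions of $(Q,\boldsymbol{\kappa})$ and of $Q$ respectively, independent of the choice of generalized barycentric coordinates. *)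

(* Defs.v *)
From HB Require Import structures.
From mathcomp Require Import all_boot all_order all_algebra.
From mathcomp Require Import all_classical all_reals all_analysis.

Set Implicit Arguments.
Unset Strict Implicit.
Unset Printing Implicit Defensive.

Import Order.TTheory GRing.Theory Num.Theory.
Import numFieldNormedType.Exports.

Local Open Scope classical_set_scope.
Local Open Scope ring_scope.

Definition lebesgue2 (R : realType) :
    {measure set (measurableTypeR R * measurableTypeR R) -> \bar R} :=
  (@lebesgue_measure R \x @lebesgue_measure R)%E.

Section Sobolev.
Context {R : realType}.
Implicit Types (W : set (R * R)) (u : R * R -> R) (g : R * R -> 'cV[R]_2).

Definition basis_vec (k : 'I_2) : R * R := ((k == 0)%:R, (k == 1)%:R).

Definition pderiv (k : 'I_2) (f : R * R -> R) : R * R -> R :=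
  'D_(basis_vec k) f.

Fixpoint Ck (n : nat) (f : R * R -> R) : Prop :=
  continuous f /\
  if n is m.+1 then
    forall k : 'I_2,
      (forall x, derivable f x (basis_vec k)) /\ Ck m (pderiv k f)
  else True.

Definition test_function W (eta : R * R -> R) : Prop :=
  [/\ forall n, Ck n eta,
      compact (closure [set x | eta x != 0]) &
      closure [set x | eta x != 0] `<=` W].

Definition in_L2 W u : Prop := u \_ W \in Lfun (lebesgue2 R) 2%:E.

Definition is_weak_gradient W u g : Prop :=
  forall k : 'I_2, in_L2 W (fun x => g x k 0) /\
    forall eta, test_function W eta ->
      \int[lebesgue2 R]_(x in W) (u x * pderiv k eta x) =
      - \int[lebesgue2 R]_(x in W) (g x k 0 * eta x).

Definition in_H1 W u : Prop := in_L2 W u /\ exists g, is_weak_gradient W u g.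

(* A representative of the weak gradient, which is unique up to a null set;
   meaningful only when [u] is in H^1(W). *)
Definition weak_gradient W u : R * R -> 'cV[R]_2 :=
  xget (fun=> 0) [set g | is_weak_gradient W u g].

End Sobolev.

Section Quadrilateral.
Context {R : realType}.
Implicit Types (V : 'I_4 -> R * R) (a b : R * R).

Definition spoint a b (t : R) : R * R := (1 - t) *: a + t *: b.

Definition segment a b : set (R * R) := spoint a b @` `[0, 1].

(* The vertices are indexed by 0, 1, 2, 3, with addition modulo 4. *)
Definition edge V (i : 'I_4) : set (R * R) := segment (V i) (V (i + 1)).

Definition boundary V : set (R * R) := \bigcup_i edge V i.

(* The bounded part of the complement of the boundary (Jordan interior). *)
Definition open_quad V : set (R * R) :=
  [set x | ~ boundary V x /\
           bounded_set (connected_component (~` boundary V) x)].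

Definition quad V : set (R * R) := open_quad V `|` boundary V.

(* These two conditions force the four vertices to be distinct. *)
Definition simple_polygon V : Prop :=
  forall i : 'I_4, edge V i `&` edge V (i + 1) = [set V (i + 1)] /\
                   edge V i `&` edge V (i + 2) = set0.

Definition cross a b : R := a.1 * b.2 - a.2 * b.1.

Definition signed_area V : R := 2^-1 * \sum_(i < 4) cross (V i) (V (i + 1)).

(* For a simple polygon the shoelace sum is plus or minus the area, with sign
   + exactly when the vertices are listed counterclockwise; its positivity thus
   expresses both the orientation and the positive area. *)
Definition is_quadrilateral V : Prop := simple_polygon V /\ 0 < signed_area V.

Definition parallelogram V : Prop :=
  forall i : 'I_4, cross (V (i + 1) - V i) (V (i + 3) - V (i + 2)) = 0.

Definition affine_on_segment (u : R * R -> R) a b : Prop :=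
  forall t, t \in `[0, 1] -> u (spoint a b t) = (1 - t) * u a + t * u b.

Record barycentric V (phi : 'I_4 -> R * R -> R) : Prop := Barycentric {
  bary_H1 : forall i, in_H1 (open_quad V) (phi i);
  bary_continuous : forall i, {within quad V, continuous (phi i)};
  bary_vertex : forall i j, phi i (V j) = (i == j)%:R;
  bary_edge : forall i j, affine_on_segment (phi i) (V j) (V (j + 1));
  bary_sum : forall p, quad V p -> \sum_(i < 4) phi i p = 1;
  bary_x : forall p, quad V p -> \sum_(i < 4) (V i).1 * phi i p = p.1;
  bary_y : forall p, quad V p -> \sum_(i < 4) (V i).2 * phi i p = p.2
}.

Definition spd (kappa : 'M[R]_2) : Prop :=
  kappa^T = kappa /\
  forall v : 'cV[R]_2, v != 0 -> 0 < (v^T *m kappa *m v) 0 0.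

(* Gradients are taken, and integrated, on the open quadrilateral: the boundary
   is a null set. *)
Definition energy V (kappa : 'M[R]_2) (u v : R * R -> R) : R :=
  \int[lebesgue2 R]_(x in open_quad V)
    ((weak_gradient (open_quad V) v x)^T *m
       (kappa *m weak_gradient (open_quad V) u x)) 0 0.

Definition stiffness V kappa (phi : 'I_4 -> R * R -> R) : 'M[R]_4 :=
  \matrix_(i, j) energy V kappa (phi j) (phi i).

Definition Psi (phi : 'I_4 -> R * R -> R) : R * R -> R :=
  fun x => 2^-1 * (- phi 0 x + phi 1 x - phi 2 x + phi 3 x).

Definition tau V kappa (phi : 'I_4 -> R * R -> R) : R :=
  energy V kappa (Psi phi) (Psi phi).

End Quadrilateral.

(* Main.v *)
(** Fix Q with signed area > 0. The relations satisfied by the coordinates give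
phi_i = L_i + c_i Psi on Q, where L_i is affine and where L_i and c_i depend
only on the vertices: c_i is, up to sign, the area of the triangle omitting V_i
divided by the area of Q. Hence
  K_ij = a(L_j, L_i) + c_j a(Psi, L_i) + c_i a(L_j, Psi) + c_i c_j tau,
and one takes B = (c_i c_j), which is (+-1/4) on every parallelogram. As the
gradients of the L_i are constant, the cross terms only involve the mean of
grad Psi over Q. Two choices of coordinates give functions Psi whose difference
w is in H^1, continuous and zero on the boundary, and the mean of grad w
vanishes: pair it with cutoffs eta_m that are 1 off a neighbourhood of the
boundary of width O(1/m) and have gradient O(m); then int w grad eta_m tends to
0 since w is small near the boundary. The same cutoffs, multiplied by products
of flat functions exp(-1/t) that approximate indicators of quadrants, show that
weak gradients are unique almost everywhere. *)
Require Import Defs.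
From mathcomp Require Import all_boot all_order all_algebra.
From mathcomp Require Import all_classical all_reals all_analysis.
From mathcomp Require Import measurable_realfun ring lra.

Set Implicit Arguments.
Unset Strict Implicit.
Unset Printing Implicit Defensive.

Import Order.TTheory GRing.Theory Num.Theory.
Import numFieldNormedType.Exports.

Local Open Scope classical_set_scope.
Local Open Scope ring_scope.

(** * Smooth functions on the plane *)

Section SmoothCalculus.
Context {R : realType}.
Implicit Types (f g : R * R -> R) (k : 'I_2) (x v : R * R).

(** The mean of grad Psi is never evaluated. Its value is fixed by the boundary values, but reading
    it off them would take a divergence theorem with traces on a polygon. Comparing two choices of
    coordinates leaves a function that vanishes on the boundary, for which interior cutoffs suffice.
    For the same reason A has no closed formula: it is the remainder K - tau B of some chosen system
    of coordinates.

    The interior of Q is made of bounded components of the complement of the boundary. The argument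
    handles it only through being open, being bounded, and having a membership that changes only
    across the boundary; convex and nonconvex shapes are thus treated alike, and the area of Q stays
    symbolic in the energy.

    [weak_gradient] picks an arbitrary representative, so that even its linearity holds only almost
    everywhere and rests on the uniqueness result. Membership in H^1 gives no pointwise control near
    the boundary; continuity of the coordinates on the closed quadrilateral supplies it. *)

Lemma CkS n f : Ck n.+1 f -> Ck n f.
Proof.
elim: n f => [|n IHn] f [cf df]; first by split.
by split=> // k; have [dk Ckk] := df k; split=> //; exact: IHn.
Qed.

Lemma Ck_continuous n f : Ck n f -> continuous f.
Proof. by case: n => [|n] []. Qed.

(** Serves functions defined by cases, such as a cutoff on Q extended by 0: near each point they
    agree with a smooth function, although no single formula shows it. *)
Lemma Ck_local n f :
  (forall x, exists2 g, Ck n g & \near x, f x = g x) -> Ck n f.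
Proof.
have cont m (h : R * R -> R) :
    (forall x, exists2 g, Ck m g & \near x, h x = g x) -> continuous h.
  move=> loc x; have [g Cg hg] := loc x.
  rewrite /continuous_at (nbhs_singleton hg).
  apply: cvg_trans; last exact: (Ck_continuous Cg).
  by apply: near_eq_cvg; apply: filterS hg => y ->.
elim: n f => [|n IHn] f loc; first by split=> //; exact: cont loc.
split; first exact: cont loc.
move=> k; split=> [x|].
  have [g [_ /(_ k)[dg _]] fg] := loc x.
  apply: near_eq_derivable (dg x).
  by apply: filterS fg => y ->.
apply: IHn => x; have [g [_ /(_ k)[_ Cg]] fg] := loc x.
exists (pderiv k g) => //.
(* A derivative at y needs agreement around y, not only at y. *)
have : \forall y \near x, \near y, f y = g y by exact/nbhs_interior.
by apply: filterS => y; exact: near_eq_derive.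
Qed.

Lemma Ck_cst n (c : R) : Ck n (fun=> c).
Proof.
elim: n c => [|n IHn] c; first by split=> // x; exact: cvg_cst.
split; first by move=> x; exact: cvg_cst.
move=> k; split=> [x|]; first exact: derivable_cst.
suff -> : pderiv k (fun=> c) = fun=> 0 by exact: IHn.
by apply/funext => x; rewrite /pderiv derive_cst.
Qed.

Lemma pderivD f g k : (forall x, derivable f x (basis_vec k)) ->
    (forall x, derivable g x (basis_vec k)) ->
  pderiv k (fun x => f x + g x) = fun x => pderiv k f x + pderiv k g x.
Proof. by move=> df dg; apply/funext => x; exact: deriveD. Qed.

Lemma pderivM f g k : (forall x, derivable f x (basis_vec k)) ->
    (forall x, derivable g x (basis_vec k)) ->
  pderiv k (fun x => f x * g x) =
  fun x => f x * pderiv k g x + g x * pderiv k f x.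
Proof. by move=> df dg; apply/funext => x; exact: deriveM. Qed.

Lemma CkD n f g : Ck n f -> Ck n g -> Ck n (fun x => f x + g x).
Proof.
elim: n f g => [|n IHn] f g [cf df] [cg dg]; split=> //.
1,2: by move=> x; apply: cvgD; [exact: cf|exact: cg].
move=> k; have [dfk Cf] := df k; have [dgk Cg] := dg k.
split=> [x|]; first exact: derivableD.
by rewrite (pderivD dfk dgk); exact: IHn.
Qed.

Lemma CkM n f g : Ck n f -> Ck n g -> Ck n (fun x => f x * g x).
Proof.
elim: n f g => [|n IHn] f g Cf Cg.
  by split=> // x; apply: cvgM; [exact: (Ck_continuous Cf)|
                                 exact: (Ck_continuous Cg)].
have [cf df] := Cf; have [cg dg] := Cg; split.
  by move=> x; apply: cvgM; [exact: cf|exact: cg].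
move=> k; have [dfk Cfk] := df k; have [dgk Cgk] := dg k.
split=> [x|]; first exact: derivableM.
by rewrite (pderivM dfk dgk); apply: CkD; apply: IHn => //; exact: CkS.
Qed.

(** Restricting f to the line t |-> t v + x reduces this to the chain rule in one variable, so a
    directional derivative of f is enough. *)
Lemma is_derive_comp1 (h : R -> R) f x v (df dh : R) :
  is_derive x v f df -> is_derive (f x) 1 h dh ->
  is_derive x v (h \o f) (dh * df).
Proof.
move=> [dfx <-] [dhx <-].
have e0 : 0 *: v + x = x by rewrite scale0r add0r.
have DE (g : R * R -> R) : 'D_v g x = (fun t : R => g (t *: v + x))^`()%classic 0.
  rewrite derive1E /derive; set g1 := fun h => _; set g2 := fun h => _.
  suff -> : g1 = g2 by [].
  by apply/funext => t; rewrite /g1 /g2/= e0 addr0 [_%:A]mulr1.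
have d1 : derivable (fun t : R => f (t *: v + x)) 0 1 by apply/(derivable1P f x v).
have d2 : derivable h (f (0 *: v + x)) 1 by rewrite e0.
split.
  apply/derivable1P/derivable1_diffP.
  apply: (@differentiable_comp _ _ _ _ (fun t : R => f (t *: v + x)) h).
    by apply/derivable1_diffP.
  by apply/derivable1_diffP.
rewrite (DE (h \o f)) (DE f).
rewrite (_ : (fun t => _) = h \o (fun t : R => f (t *: v + x)))//.
by rewrite (derive1_comp d1 d2) derive1E e0.
Qed.

End SmoothCalculus.

(** * Flat functions at the origin *)

Section FlatFunction.
Context {R : realType}.
Implicit Types (m n : nat) (t : R) (f : R * R -> R).

(** The powers of 1/t are included so that the family is closed under differentiation, up to linear
    combinations; smoothness then follows by induction. *)
Definition flat m t : R := if 0 < t then t^-1 ^+ m * expR (- t^-1) else 0.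

Lemma flat_ge0 m t : 0 <= flat m t.
Proof.
rewrite /flat; case: ifPn => // t0.
by rewrite mulr_ge0 ?expR_ge0// exprn_ge0// invr_ge0 ltW.
Qed.

(** With z = 1/t this is exp z >= z^(m+1) / (m+1)!. It is the estimate behind the derivative at
    0. *)
Lemma flat_le m t : flat m t <= (m.+1)`!%:R * `|t|.
Proof.
rewrite /flat; case: ifPn => [t0|_]; last by rewrite mulr_ge0.
have z0 : 0 < t^-1 by rewrite invr_gt0.
rewrite gtr0_norm// expRN ler_pdivrMr ?expR_gt0//.
have c0 : (0 : R) < m.+1`!%:R by rewrite ltr0n fact_gt0.
have -> : t^-1 ^+ m = m.+1`!%:R * t * (t^-1 ^+ m.+1 / m.+1`!%:R).
  by rewrite exprS; field; rewrite !gt_eqF.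
rewrite ler_pM2l ?mulr_gt0// (le_trans _ (expR_ge1Dxn m (ltW z0)))//.
by rewrite lerDr.
Qed.

Lemma is_derive_flat m t :
  is_derive t 1 (flat m) (- m%:R * flat m.+1 t + flat m.+2 t).
Proof.
have [t0|t0|->] := ltgtP t 0.
- rewrite /flat ltNge (ltW t0)/= mulr0 addr0.
  apply: (@near_eq_is_derive _ _ _ (cst 0)).
  near=> s; rewrite ifF//; apply/negbTE; rewrite -leNgt ltW//.
  by near: s; exact: lt_nbhsl.
- apply: (@near_eq_is_derive _ _ _ (fun s : R => s^-1 ^+ m * expR (- s^-1))).
    near=> s; rewrite /flat ifT//.
    by near: s; exact: lt_nbhsr.
  have t_neq0 : t != 0 by rewrite gt_eqF.
  have dV : is_derive t 1 (fun s : R => s^-1) (- t^-1 ^+ 2).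
    apply: (is_derive_eq (@is_deriveV R id t 1 1 t_neq0 (is_derive_id _ _))).
    by rewrite exprVn; exact: mulr1.
  have dE : is_derive t 1 (fun s : R => expR (- s^-1)) (expR (- t^-1) * t^-1 ^+ 2).
    apply: (@is_derive1_comp R expR (fun s : R => - s^-1)).
    by apply: (is_derive_eq (is_deriveN dV)); rewrite opprK.
  rewrite (_ : (fun s : R => s^-1 ^+ m * _) =
    (fun s : R => s^-1) ^+ m * (fun s : R => expR (- s^-1))); last first.
    by apply/funext => s; rewrite /GRing.mul/= exprfctE.
  apply: (is_derive_eq (is_deriveM (is_deriveX m dV) dE)).
  rewrite /flat t0 /GRing.scale/= exprfctE.
  case: m => [|m]; first by rewrite !expr0; ring.
  by rewrite /= !exprS -mulr_natl; ring.
- rewrite /flat ltxx mulr0 addr0.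
  have d0 : (fun h => h^-1 *: ((flat m \o shift 0) (h *: 1) - flat m 0)) @ 0^'
      --> (0 : R).
    apply/cvgr0Pnorm_le => e e0.
    near=> h.
    have h0 : h != 0 by near: h; exact: nbhs_dnbhs_neq.
    rewrite /= addr0 [_%:A]mulr1 {2}/flat ltxx subr0.
    (* The difference quotient at 0 is again a member of the family, to which the linear bound
       applies. *)
    have -> : h^-1 *: flat m h = flat m.+1 h.
      rewrite /flat; case: ifP => _; last exact: mulr0.
      by rewrite exprS /GRing.scale/= mulrA.
    rewrite ger0_norm ?flat_ge0// (le_trans (flat_le _ _))//.
    rewrite mulrC -ler_pdivlMr ?ltr0n ?fact_gt0//.
    near: h; apply: dnbhs0_le.
    by rewrite divr_gt0 ?ltr0n ?fact_gt0.
  apply: DeriveDef; first by apply/cvg_ex; exists 0.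
  exact: cvg_lim d0.
Unshelve. all: by end_near. Qed.

Lemma flat_continuous m : continuous (flat m).
Proof.
move=> t; apply: differentiable_continuous; apply/derivable1_diffP.
by have [] := is_derive_flat m t.
Qed.

Lemma Ck_flat n m f : Ck n f -> Ck n (fun x => flat m (f x)).
Proof.
elim: n m f => [|n IHn] m f Cf.
  split=> // x; apply: continuous_comp; first exact: (Ck_continuous Cf).
  exact: flat_continuous.
have [cf df] := Cf; split.
  by move=> x; apply: continuous_comp; [exact: cf|exact: flat_continuous].
move=> k; have [dfk Cfk] := df k.
have dc x : is_derive x (basis_vec k) (flat m \o f)
    ((- m%:R * flat m.+1 (f x) + flat m.+2 (f x)) * pderiv k f x).
  apply: is_derive_comp1 (is_derive_flat m (f x)).
  exact/derivableP.
split=> [x|]; first by have [] := dc x.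
rewrite (_ : pderiv k _ = fun x =>
  (- m%:R * flat m.+1 (f x) + flat m.+2 (f x)) * pderiv k f x); last first.
  by apply/funext => x; have [_ <-] := dc x.
have CfS := CkS Cf.
apply: CkM Cfk; apply: CkD; last exact: IHn.
by apply: CkM; [exact: Ck_cst|exact: IHn].
Qed.

End FlatFunction.

(** * Measurability in the plane *)

Section PlaneMeasurability.
Context {R : realType}.
Local Notation R2 := (measurableTypeR R * measurableTypeR R)%type.
Local Notation mu := (lebesgue2 R).

(** The plane carries the product sigma-algebra, so an open set is written as a countable union of
    boxes with rational corners. *)
Lemma open_measurable2 (U : set (R * R)) : open U -> measurable (U : set R2).
Proof.
move=> oU.
pose box (q : (rat * rat) * (rat * rat)) : set R2 :=
  `]ratr q.1.1, ratr q.1.2[%classic `*` `]ratr q.2.1, ratr q.2.2[%classic.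
pose F q : set R2 := if `[< box q `<=` U >] then box q else set0.
have -> : U = \bigcup_q F q.
  apply/seteqP; split=> [p Up|p [q _]]; last first.
    by rewrite /F; case: asboolP => // bU /bU.
  have /nbhs_ballP[e /= e0 pe] : nbhs p U by exact: open_nbhs_nbhs.
  have lte (x : R) : x - e < x by rewrite ltrBlDr ltrDl.
  have gte (x : R) : x < x + e by rewrite ltrDl.
  have [a Ha] := rat_in_itvoo (lte p.1).
  move: Ha; rewrite in_itv/= => /andP[a1 a2].
  have [b Hb] := rat_in_itvoo (gte p.1).
  move: Hb; rewrite in_itv/= => /andP[b1 b2].
  have [c Hc] := rat_in_itvoo (lte p.2).
  move: Hc; rewrite in_itv/= => /andP[c1 c2].
  have [d Hd] := rat_in_itvoo (gte p.2).
  move: Hd; rewrite in_itv/= => /andP[d1 d2].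
  exists ((a, b), (c, d)) => //; rewrite /F; case: asboolP => [_|].
    by split; rewrite /= in_itv/= ?a2 ?b1 ?c2 ?d1.
  case=> q [/=]; rewrite !in_itv/= => /andP[aq qb] /andP[cq qd].
  by apply: pe; split; rewrite /ball/= ltr_norml; apply/andP; split; lra.
apply: countable_bigcupT_measurable => // q.
rewrite /F; case: asboolP => // _.
by apply: measurableX; exact: measurable_itv.
Qed.

Lemma continuous_measurable2 (f : R * R -> R) :
  continuous f -> measurable_fun setT (f : R2 -> R).
Proof.
move=> /continuousP cf.
apply: (measurability _ (measurable_realfun.RGenOInfty.measurableE R)).
move=> _ [_ [a ->] <-]; rewrite setTI; apply: open_measurable2.
exact/cf/interval_open.
Qed.

(** A pi-system generating the product sigma-algebra, chosen because its indicators are limits of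
    products of two flat functions, one in each variable. *)
Definition quadrants : set (set R2) :=
  [set A | exists a b : R, A = `]a, +oo[%classic `*` `]b, +oo[%classic].

Lemma setI_closed_quadrants : setI_closed quadrants.
Proof.
move=> _ _ [a [b ->]] [c [d ->]]; exists (Num.max a c), (Num.max b d).
apply/seteqP; split=> -[x y] /=; rewrite !in_itv/= !andbT !gt_max.
  by move=> [[-> ->] [-> ->]].
by move=> [/andP[-> ->] /andP[-> ->]].
Qed.

Lemma measurable_quadrants : @measurable _ R2 = <<s quadrants >>.
Proof.
apply/seteqP; split; last first.
  apply: smallest_sub; first exact: sigma_algebra_measurable.
  by move=> _ [a [b ->]]; apply: measurableX; exact: measurable_itv.
(* Half-planes are countable unions of quadrants whose other corner coordinate tends to minus
   infinity; hence both projections are measurable for the generated sigma-algebra. *)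
have half1 a : <<s quadrants >> (`]a, +oo[%classic `*` setT).
  rewrite (_ : _ `*` _ = \bigcup_n (`]a, +oo[%classic `*` `](- n%:R)%R, +oo[%classic)).
    apply: (@bigcupT_measurable _ (g_sigma_algebraType quadrants)) => n.
    by apply: sub_sigma_algebra; exists a, (- n%:R).
  apply/seteqP; split=> -[x y] /=.
    move=> [xa _]; exists (Num.bound `|y|) => //; split=> //=.
    rewrite in_itv/= andbT.
    by have := archi_boundP (normr_ge0 y); rewrite ltr_norml => /andP[].
  by move=> [n _ [/= h1 h2]]; split.
have half2 a : <<s quadrants >> (setT `*` `]a, +oo[%classic).
  rewrite (_ : _ `*` _ = \bigcup_n (`](- n%:R)%R, +oo[%classic `*` `]a, +oo[%classic)).
    apply: (@bigcupT_measurable _ (g_sigma_algebraType quadrants)) => n.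
    by apply: sub_sigma_algebra; exists (- n%:R), a.
  apply/seteqP; split=> -[x y] /=.
    move=> [_ ya]; exists (Num.bound `|x|) => //; split=> //=.
    rewrite in_itv/= andbT.
    by have := archi_boundP (normr_ge0 x); rewrite ltr_norml => /andP[].
  by move=> [n _ [/= h1 h2]]; split.
pose S := g_sigma_algebraType quadrants.
have m1 : measurable_fun setT (fst : S -> R).
  apply: (measurability _ (measurable_realfun.RGenOInfty.measurableE R)).
  move=> _ [_ [a ->] <-]; rewrite setTI.
  rewrite (_ : _ @^-1` _ = `]a, +oo[%classic `*` setT); first exact: half1.
  by apply/seteqP; split=> -[x y] //= [].
have m2 : measurable_fun setT (snd : S -> R).
  apply: (measurability _ (measurable_realfun.RGenOInfty.measurableE R)).
  move=> _ [_ [a ->] <-]; rewrite setTI.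
  rewrite (_ : _ @^-1` _ = setT `*` `]a, +oo[%classic); first exact: half2.
  by apply/seteqP; split=> -[x y] //= [].
apply: smallest_sub; first exact: smallest_sigma_algebra.
move=> A [[B mB <-]|[B mB <-]].
  exact: (m1 measurableT B).
exact: (m2 measurableT B).
Qed.

End PlaneMeasurability.

(** * Integration by parts *)

Section BoundedSupport.
Context {R : realType}.
Local Notation R2 := (measurableTypeR R * measurableTypeR R)%type.
Local Notation mu := (lebesgue2 R).
Implicit Types (f : R * R -> R) (M : R).

Lemma norm_pair_le (x : R * R) M :
  (`|x| <= M) = (`|x.1| <= M) && (`|x.2| <= M).
Proof. by rewrite prod_normE ge_max. Qed.

Definition square M : set (R * R) := `[- M, M]%classic `*` `[- M, M]%classic.

Lemma squareP M (x : R * R) : square M x <-> `|x| <= M.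
Proof.
rewrite norm_pair_le !ler_norml; split.
  by move=> [/=]; rewrite !in_itv/= => -> ->.
by move=> /andP[xM yM]; split; rewrite /= in_itv.
Qed.

Lemma compact_square M : compact (square M).
Proof. by apply: compact_setX; exact: segment_compact. Qed.

Lemma measurable_square M : measurable (square M : set R2).
Proof. by apply: measurableX; exact: measurable_itv. Qed.

Lemma lebesgue2_rect (a b c d : R) : a <= b -> c <= d ->
  mu (`[a, b]%classic `*` `[c, d]%classic) = ((b - a) * (d - c))%:E.
Proof.
move=> ab cd; apply: etrans (product_measure1E _ _ _ _) _ => //.
rewrite /=.
rewrite !lebesgue_measure_itv/= !lte_fin -!EFinD.
move: ab cd; rewrite !le_eqVlt => /predU1P[->|ab] /predU1P[->|cd].
- by rewrite !ltxx !subrr !mul0e mul0r.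
- by rewrite ltxx subrr mul0e mul0r.
- by rewrite ltxx subrr mule0 mulr0.
- by rewrite ab cd -EFinM.
Qed.

Lemma lebesgue2_square M : (mu (square M) < +oo)%E.
Proof.
have [M0|M0] := leP 0 M.
  by rewrite lebesgue2_rect ?ltry// ge0_cp.
rewrite (_ : square M = set0) ?measure0//.
by apply/seteqP; split=> // x /squareP /le_lt_trans /(_ M0); rewrite normr_lt0.
Qed.

Lemma integrable_continuous_square f M : continuous f ->
  mu.-integrable (square M) (EFin \o f).
Proof.
move=> cf; apply: measurable_bounded_integrable.
- exact: measurable_square.
- exact: lebesgue2_square.
- by apply: measurable_funTS; exact: continuous_measurable2.
- have cfs : compact (f @` square M).
    apply: continuous_compact; last exact: compact_square.
    exact: continuous_subspaceT.
  have [B [_ fB]] := compact_bounded cfs.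
  exists B; split=> [|B' BB' x sx]; first exact: num_real.
  by apply: fB => //; exists x.
Qed.

Definition supported M f := forall x, M < `|x| -> f x = 0.

Lemma continuous_supported_integrable f M : continuous f -> supported M f ->
  mu.-integrable setT (EFin \o f).
Proof.
move=> cf sf.
have -> : EFin \o f = (EFin \o f) \_ (square M).
  apply/funext => x; rewrite patchE; case: ifPn => //.
  rewrite notin_setE => /squareP/negP; rewrite -ltNge => /sf /=.
  by move=> ->.
apply/integrable_restrict => //; first exact: measurable_square.
by rewrite setTI; exact: integrable_continuous_square.
Qed.

Lemma supported_pderiv f M k : supported M f -> supported M (pderiv k f).
Proof.
move=> sf x Mx; rewrite /pderiv -(derive_cst (0 : R) x (basis_vec k)).
apply: near_eq_derive.
have : nbhs x [set y | M < `|y|].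
  apply: (@cvgr_gt R _ (nbhs x) _ (fun y : R * R => `|y|) `|x|) => //.
  exact: norm_continuous.
by apply: filterS => y; exact: sf.
Qed.

Lemma integral_derive_supported (h h' : R -> R) M :
    (forall y : R, is_derive y 1 h (h' y)) -> continuous h' ->
    (forall y : R, M < `|y| -> h y = 0) -> (forall y : R, M < `|y| -> h' y = 0) ->
  (\int[lebesgue_measure]_y (h' y)%:E = 0)%E.
Proof.
move=> dh ch' h0 h'0.
(* M may be negative; N is positive and exceeds M, so h vanishes at both ends of [-N, N]. *)
pose N : R := `|M| + 1.
have N0 : 0 < N by rewrite ltr_wpDl.
have MN : M < N by rewrite (le_lt_trans (ler_norm M))// ltrDl.
have ch : continuous h.
  move=> y; apply: differentiable_continuous; apply/derivable1_diffP.
  by have [] := dh y.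
have -> : (\int[lebesgue_measure]_y (h' y)%:E =
    \int[lebesgue_measure]_(y in `[(- N)%R, N]) (h' y)%:E)%E.
  rewrite [RHS]integral_mkcond; apply: eq_integral => y _; rewrite patchE.
  case: ifPn => //; rewrite notin_setE/= in_itv/= -ler_norml => /negP.
  by rewrite -ltNge => Ny; rewrite h'0// (lt_trans MN).
rewrite (@continuous_FTC2 _ h' h) ?h0 ?subee//.
- by rewrite normrN gtr0_norm.
- by rewrite gtr0_norm.
- by rewrite gtrN.
- exact: continuous_subspaceT.
- split.
  + by move=> y _; have [] := dh y.
  + by apply: cvg_at_right_filter; exact: ch.
  + by apply: cvg_at_left_filter; exact: ch.
- by move=> y _; rewrite derive1E; have [_ ->] := dh y.
Qed.

Lemma is_derive_section1 f (x y : R) : derivable f (x, y) (basis_vec 0) ->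
  is_derive x 1 (fun t : R => f (t, y)) (pderiv 0 f (x, y)).
Proof.
have E : (fun h : R => h^-1 *: (((fun t : R => f (t, y)) \o shift x)%FUN (h *: 1) -
      f (x, y))) =
    (fun h : R => h^-1 *: ((f \o shift (x, y)) (h *: basis_vec 0) - f (x, y))).
  apply/funext => h /=; congr (_ *: (f (_, _) - _)) => /=.
  by rewrite scaler0 add0r.
by move=> df; split; rewrite /pderiv /derivable /derive/= E.
Qed.

Lemma is_derive_section2 f (x y : R) : derivable f (x, y) (basis_vec 1) ->
  is_derive y 1 (fun t : R => f (x, t)) (pderiv 1 f (x, y)).
Proof.
have E : (fun h : R => h^-1 *: (((fun t : R => f (x, t)) \o shift y)%FUN (h *: 1) -
      f (x, y))) =
    (fun h : R => h^-1 *: ((f \o shift (x, y)) (h *: basis_vec 1) - f (x, y))).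
  apply/funext => h /=; congr (_ *: (f (_, _) - _)) => /=.
  by rewrite scaler0 add0r.
by move=> df; split; rewrite /pderiv /derivable /derive/= E.
Qed.

(** Fubini, integrating first in the variable of differentiation: each line contributes 0 by the
    fundamental theorem of calculus. *)
Lemma integral_pderiv_supported f k M : continuous f ->
    (forall x, derivable f x (basis_vec k)) -> continuous (pderiv k f) ->
    supported M f ->
  \int[mu]_x pderiv k f x = 0.
Proof.
move=> cf df cdf sf; have sdf := supported_pderiv k sf.
have ig := continuous_supported_integrable cdf sdf.
have sec1 (g : R * R -> R) (y : R) : continuous g ->
    continuous (fun t : R => g (t, y)).
  move=> cg t; apply: (@continuous_comp _ _ _ (fun t : R => (t, y)) g) ; last exact: cg.
  exact: (@cvg_pair _ _ _ (nbhs t) (nbhs t) (nbhs y) _ _ _ id (fun=> y)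
    cvg_id (cvg_cst y)).
have sec2 (g : R * R -> R) (x : R) : continuous g ->
    continuous (fun t : R => g (x, t)).
  move=> cg t; apply: (@continuous_comp _ _ _ (fun t : R => (x, t)) g) ; last exact: cg.
  exact: (@cvg_pair _ _ _ (nbhs t) (nbhs x) (nbhs t) _ _ _ (fun=> x) id
    (cvg_cst x) cvg_id).
have ns1 (x y : R) : M < `|x| -> M < `|(x, y)|.
  by rewrite prod_normE/= lt_max => ->.
have ns2 (x y : R) : M < `|y| -> M < `|(x, y)|.
  by rewrite prod_normE/= lt_max orbC => ->.
rewrite /Rintegral; suff -> : (\int[mu]_x (pderiv k f x)%:E = 0)%E by [].
have [k0|k1] : k = 0 \/ k = 1.
  by case: k {df cdf sdf ig} => -[|[|//]] i; [left|right]; exact: val_inj.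
- rewrite k0 in df cdf sdf ig *.
  rewrite /lebesgue2 -integral21_prod_meas1//.
  rewrite integral0_eq// => y _.
  apply: (@integral_derive_supported (fun t => f (t, y)) _ M).
  + by move=> x; exact: is_derive_section1.
  + exact: sec1.
  + by move=> x Mx; apply: sf; exact: ns1.
  + by move=> x Mx; apply: sdf; exact: ns1.
- rewrite k1 in df cdf sdf ig *.
  rewrite /lebesgue2 -integral12_prod_meas1//.
  rewrite integral0_eq// => x _.
  apply: (@integral_derive_supported (fun t => f (x, t)) _ M).
  + by move=> y; exact: is_derive_section2.
  + exact: sec2.
  + by move=> y My; apply: sf; exact: ns2.
  + by move=> y My; apply: sdf; exact: ns2.
Qed.

End BoundedSupport.

(** * Topology of a polygon *)

Section PolygonTopology.
Context {R : realType}.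
Implicit Types (V : 'I_4 -> R * R) (a b x y : R * R).

Lemma spointE a b (t : R) : spoint a b t = a + t *: (b - a).
Proof. by rewrite /spoint scalerBl scale1r scalerBr addrAC addrA. Qed.

Lemma continuous_spoint a b : continuous (spoint a b : R -> R * R).
Proof.
rewrite (_ : spoint a b = fun t : R => a + t *: (b - a)); last first.
  by apply/funext => t; exact: spointE.
by move=> t; apply: cvgD; [exact: cvg_cst|exact: scalel_continuous].
Qed.

Lemma compact_segment a b : compact (segment a b).
Proof.
apply: continuous_compact; last exact: segment_compact.
exact/continuous_subspaceT/continuous_spoint.
Qed.

Lemma connected_segment a b : connected (segment a b).
Proof.
apply: connected_continuous_connected; first exact: segment_connected.
exact/continuous_subspaceT/continuous_spoint.
Qed.

Lemma boundaryE V : boundary V =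
  edge V 0 `|` edge V 1 `|` edge V 2%:R `|` edge V 3%:R.
Proof.
apply/seteqP; split=> [x [i _]|x].
  have : (((i == 0) || (i == 1)) || (i == 2%:R)) || (i == 3%:R).
    by case: i => -[|[|[|[|]]]].
  by move=> /orP[/orP[/orP[]|]|] /eqP <- Vx;
    [do 3 left|do 2 left; right|left; right|right].
by move=> [[[|]|]|] Vx; eexists; eauto.
Qed.

Lemma compact_boundary V : compact (boundary V).
Proof. by rewrite boundaryE; do !apply: compactU; exact: compact_segment. Qed.

Lemma closed_boundary V : closed (boundary V).
Proof. by apply: compact_closed; [exact: norm_hausdorff|exact: compact_boundary]. Qed.

Lemma boundary_bounded V : exists M, forall x, boundary V x -> `|x| <= M.
Proof.
have [M [_ HM]] := compact_bounded (@compact_boundary V).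
by exists (M + 1); apply: HM; rewrite ltrDl.
Qed.

Lemma ball_connected_component (A : set (R * R)) x (e : R) : ball x e `<=` A ->
  ball x e `<=` connected_component A x.
Proof.
move=> xeA y xey.
apply: (@connected_component_max _ A (segment x y)).
- by exists 0; [rewrite /= in_itv/= lexx ler01|rewrite spointE scale0r addr0].
- move=> _ [t t01 <-]; move: t01; rewrite /= in_itv/= => /andP[t0 t1].
  apply: xeA.
  move: xey; rewrite -ball_normE/= spointE opprD addNKr normrN normrZ distrC.
  by apply: le_lt_trans; rewrite ger0_norm// ler_piMl.
- exact: connected_segment.
- by exists 1; [rewrite /= in_itv/= lexx ler01|rewrite spointE scale1r addrC subrK].
Qed.

(** A ball avoiding the boundary lies in a single component of the complement. The equivalence is
    needed both ways: for openness of the interior, and for cutoffs to vanish near exterior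
    points. *)
Lemma near_open_quadE V x : ~ boundary V x ->
  \forall y \near x, open_quad V y <-> open_quad V x.
Proof.
move=> Vx; have : nbhs x (~` boundary V).
  by apply: open_nbhs_nbhs; split => //; exact/closed_openC/closed_boundary.
move=> /nbhs_ballP[e /= e0 xeV].
apply/nbhs_ballP; exists e => //= y xey.
have /same_connected_component E := ball_connected_component xeV xey.
split=> -[_ bd].
  by split=> //; rewrite E.
by split; [exact: xeV|rewrite -E].
Qed.

Lemma open_open_quad V : open (open_quad V).
Proof.
rewrite openE => x Wx; have := near_open_quadE Wx.1.
by apply: filterS => y [_]; exact.
Qed.

(** From a point farther from the origin than the whole boundary, the outward ray never meets the
    boundary, so the component of that point is unbounded. *)
Lemma open_quad_bounded V : exists M, forall x, open_quad V x -> `|x| <= M.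
Proof.
have [M VM] := boundary_bounded V.
exists `|M| => x [nVx [N [_ bd]]]; rewrite leNgt; apply/negP => Mx.
have x0 : 0 < `|x| by rewrite (le_lt_trans _ Mx).
pose r (t : R) : R * R := t *: x.
have ray : r @` `[1, +oo[ `<=` connected_component (~` boundary V) x.
  apply: connected_component_max.
  - by exists 1; rewrite /r ?scale1r//= in_itv/= lexx.
  - move=> _ [t t1 <-] /VM; move: t1; rewrite /= in_itv/= andbT => t1.
    apply/negP; rewrite -ltNge /r normrZ ger0_norm ?(le_trans _ t1)//.
    by rewrite (le_lt_trans (ler_norm M))// (lt_le_trans Mx)// ler_peMl.
  - apply: connected_continuous_connected.
      exact/connected_intervalP/interval_is_interval.
    by apply: continuous_subspaceT => t; exact: scalel_continuous.
(* Chosen so that the norm of [r t] is |x| + |N| + 1, beyond the bound N of the component. *)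
pose t : R := 1 + (`|N| + 1) / `|x|.
have t1 : 1 <= t by rewrite lerDl divr_ge0// ltW// ltr_wpDl.
have : connected_component (~` boundary V) x (r t).
  by apply: ray; exists t => //=; rewrite in_itv/= t1.
have lN : N < `|N| + 1 by rewrite (le_lt_trans (ler_norm N)) ?ltrDl.
move=> /(bd _ lN) /=; rewrite /r normrZ ger0_norm ?(le_trans _ t1)//.
by rewrite /t mulrDl mul1r divfK ?gt_eqF// gerDr leNgt x0.
Qed.

End PolygonTopology.

(** * Cutoff functions *)

Section SmoothStep.
Context {R : realType}.
Implicit Types (t : R).

Lemma flat0_mono (s t : R) : s <= t -> flat 0 s <= flat 0 t.
Proof.
move=> st; rewrite /flat !expr0 !mul1r.
have [s0|s0] := ltP 0 s; last by case: ifP => // _; exact: expR_ge0.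
by rewrite (lt_le_trans s0 st) ler_expR lerN2 lef_pV2 ?posrE// (lt_le_trans s0).
Qed.

Lemma flat_le0 m t : t <= 0 -> flat m t = 0.
Proof. by move=> t0; rewrite /flat ltNge t0. Qed.

Let c : R := flat 0 1.

Let c_gt0 : 0 < c.
Proof. by rewrite /c /flat ltr01 expr0 mul1r expR_gt0. Qed.

Let fc_gt0 : 0 < flat 0 c.
Proof. by rewrite [flat 0 c]/flat c_gt0 expr0 mul1r expR_gt0. Qed.

(** A smooth descent from 1 on t <= 0 to 0 on t >= 1. Nesting flat functions, instead of the usual
    quotient f(1 - t) / (f(t) + f(1 - t)), leaves only a constant denominator. *)
Definition step t : R := flat 0 (flat 0 1 - flat 0 t) / flat 0 (flat 0 1).

Definition dstep t : R :=
  - (flat 2 (flat 0 1 - flat 0 t) * flat 2 t / flat 0 (flat 0 1)).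

Lemma step_le0 t : t <= 0 -> step t = 1.
Proof. by move=> t0; rewrite /step (flat_le0 0 t0) subr0 divff// gt_eqF. Qed.

Lemma step_ge1 t : 1 <= t -> step t = 0.
Proof. by move=> /flat0_mono t1; rewrite /step flat_le0 ?subr_le0// mul0r. Qed.

Lemma step_itv t : 0 <= step t <= 1.
Proof.
rewrite /step divr_ge0 ?flat_ge0//= ler_pdivrMr// mul1r.
by apply: flat0_mono; rewrite gerBl flat_ge0.
Qed.

Lemma dstep_ge1 t : 1 <= t -> dstep t = 0.
Proof.
by move=> /flat0_mono t1; rewrite /dstep flat_le0 ?subr_le0// !mul0r oppr0.
Qed.

Lemma is_derive_step t : is_derive t 1 step (dstep t).
Proof.
have d1 : is_derive t 1 (flat 0 : R -> R) (flat 2 t).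
  by apply: (is_derive_eq (is_derive_flat 0 t)); rewrite oppr0 mul0r add0r.
have d2 : is_derive t 1 (fun u : R => flat 0 1 - flat 0 u) (- flat 2 t).
  by apply: (is_derive_eq (is_deriveB (is_derive_cst (flat 0 1) t 1) d1)); rewrite sub0r.
have d3 : is_derive (flat 0 1 - flat 0 t) 1 (flat 0 : R -> R)
    (flat 2 (flat 0 1 - flat 0 t)).
  by apply: (is_derive_eq (is_derive_flat 0 _)); rewrite oppr0 mul0r add0r.
have d4 := @is_derive1_comp R (flat 0) (fun u => flat 0 1 - flat 0 u) t _ _ d3 d2.
have := is_deriveZ (flat 0 (flat 0 1))^-1 d4.
rewrite (_ : _ \*: _ = step); last first.
  by apply/funext => u; rewrite /step mulrC.
by move=> H; apply: (is_derive_eq H); rewrite /dstep /GRing.scale/=; ring.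
Qed.

Lemma dstep_bounded : exists2 L : R, 0 <= L & forall t, `|dstep t| <= L.
Proof.
(* Each 6 is 3! from [flat_le] at m = 2, for arguments at most c and at most 1; [dstep] vanishes
   outside ]0, 1[. *)
exists (6 * c * 6 / flat 0 c).
  by rewrite divr_ge0 ?mulr_ge0// ltW.
move=> t; have L0 : 0 <= 6 * c * 6 / flat 0 c by rewrite divr_ge0 ?mulr_ge0// ltW.
have [t1|t1] := leP 1 t; first by rewrite dstep_ge1// normr0.
have [t0|t0] := leP t 0; first by rewrite /dstep (flat_le0 2 t0) mulr0 mul0r oppr0 normr0.
rewrite /dstep normrN ger0_norm; last by rewrite !mulr_ge0 ?invr_ge0 ?flat_ge0.
rewrite ler_pM2r ?invr_gt0// ler_pM ?flat_ge0//.
  rewrite (le_trans (flat_le _ _))// ler_pM2l ?ltr0n//.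
  by rewrite ger0_norm ?gerBl ?flat_ge0// subr_ge0 flat0_mono// ltW.
rewrite (le_trans (flat_le _ _))// gtr0_norm//.
by rewrite -[leRHS]mulr1 ler_pM// ltW.
Qed.

Lemma Ck_step n (f : R * R -> R) : Ck n f -> Ck n (fun x => step (f x)).
Proof.
move=> Cf; apply: CkM; last exact: Ck_cst.
apply: Ck_flat; apply: CkD; first exact: Ck_cst.
rewrite (_ : (fun x => _) = fun x => (-1) * flat 0 (f x)); last first.
  by apply/funext => x; rewrite mulN1r.
by apply: CkM; [exact: Ck_cst|exact: Ck_flat].
Qed.

End SmoothStep.

Section Affine.
Context {R : realType}.
Implicit Types (x v : R * R).

Definition aff (al be ga : R) x : R := al * x.1 + be * x.2 + ga.

Lemma is_derive_const_slope (f : R * R -> R) x v (d : R) :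
  (forall h : R, f (h *: v + x) = f x + h * d) -> is_derive x v f d.
Proof.
move=> fE.
have cv : (fun h => h^-1 *: ((f \o shift x) (h *: v) - f x)) @ 0^' --> d.
  apply: cvg_near_cst; near=> h.
  have h0 : h != 0 by near: h; exact: nbhs_dnbhs_neq.
  by rewrite /= fE addrAC subrr add0r /GRing.scale/= mulKf.
by apply: DeriveDef; [apply/cvg_ex; exists d|exact: cvg_lim cv].
Unshelve. all: by end_near. Qed.

Lemma is_derive_aff (al be ga : R) x v :
  is_derive x v (aff al be ga) (al * v.1 + be * v.2).
Proof.
apply: is_derive_const_slope => h; rewrite /aff/= /GRing.scale/=.
by ring.
Qed.

Lemma Ck_aff n (al be ga : R) : Ck n (aff al be ga).
Proof.
have ca : continuous (aff al be ga).
  move=> x; apply: cvgD; last exact: cvg_cst.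
  by apply: cvgD; apply: cvgMr; [exact: cvg_fst|exact: cvg_snd].
case: n => [|n]; split=> // k; split=> [x|].
  by have [] := is_derive_aff al be ga x (basis_vec k).
rewrite (_ : pderiv k _ = fun=> al * (basis_vec k).1 + be * (basis_vec k).2).
  exact: Ck_cst.
by apply/funext => x; have [_ <-] := is_derive_aff al be ga x (basis_vec k).
Qed.

End Affine.

(** * Smooth functions with values in [0, 1] that are constant off a set *)

Section Transition.
Context {R : realType}.
Implicit Types (f g : R * R -> R) (L : R) (S : set (R * R)).

(** With c = 0 products localise to intersections of the sets S, with c = 1 to unions;
    complementation passes from the first kind to the second. The gradient has its own clause
    because a point outside S may be a limit of points of S. *)
Record transition L S (c : R) f : Prop := Transition {
  transition_Ck : forall n, Ck n f;
  transition_itv : forall x, 0 <= f x <= 1;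
  transition_pderiv : forall k x, `|pderiv k f x| <= L;
  transition_cst : forall x, ~ S x -> f x = c /\ forall k, pderiv k f x = 0
}.

Lemma transition_sub L S S' c f : S `<=` S' ->
  transition L S c f -> transition L S' c f.
Proof.
by move=> SS' [? ? ? cstf]; split=> // x S'x; apply: cstf => /SS'.
Qed.

Lemma transition_le L L' S c f : L <= L' ->
  transition L S c f -> transition L' S c f.
Proof.
by move=> LL' [? ? dL ?]; split=> // k x; rewrite (le_trans (dL k x)).
Qed.

Lemma Ck_derivable f k x : (forall n, Ck n f) -> derivable f x (basis_vec k).
Proof. by move=> Cf; have [_ /(_ k)[]] := Cf 1%N. Qed.

Lemma transition_pderivM L L' S S' c c' f g k x :
    transition L S c f -> transition L' S' c' g ->
  pderiv k (fun y => f y * g y) x = f x * pderiv k g x + g x * pderiv k f x.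
Proof.
by move=> tf tg; rewrite pderivM// => y; apply: Ck_derivable => n;
  [exact: transition_Ck tf _|exact: transition_Ck tg _].
Qed.

(** In the product rule both undifferentiated factors lie in [0, 1], so the gradient bounds simply
    add. *)
Lemma transition_mul_aux L L' S S' c c' f g (U : set (R * R)) d :
    transition L S c f -> transition L' S' c' g ->
    (forall x, ~ U x -> f x * g x = d /\
      forall k, f x * pderiv k g x + g x * pderiv k f x = 0) ->
  transition (L + L') U d (fun x => f x * g x).
Proof.
move=> tf tg cstU; split.
- by move=> n; apply: CkM; [exact: transition_Ck tf _|exact: transition_Ck tg _].
- move=> x; have /andP[f0 f1] := transition_itv tf x.
  have /andP[g0 g1] := transition_itv tg x.
  by rewrite mulr_ge0//= mulr_ile1.
- move=> k x; rewrite (transition_pderivM _ _ tf tg) addrC.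
  have /andP[f0 f1] := transition_itv tf x.
  have /andP[g0 g1] := transition_itv tg x.
  rewrite (le_trans (ler_normD _ _))// !normrM (ger0_norm f0) (ger0_norm g0) lerD//.
    by rewrite (le_trans _ (transition_pderiv tf k x))// ler_piMl.
  by rewrite (le_trans _ (transition_pderiv tg k x))// ler_piMl.
- move=> x /cstU[E1 E2]; split=> // k.
  by rewrite (transition_pderivM _ _ tf tg).
Qed.

Lemma transition0M L L' S S' f g :
    transition L S 0 f -> transition L' S' 0 g ->
  transition (L + L') (S `&` S') 0 (fun x => f x * g x).
Proof.
move=> tf tg; apply: (transition_mul_aux tf tg) => x /not_andP[Sx|Sx].
  by have [-> dE] := transition_cst tf Sx; split=> [|k]; rewrite ?dE mul0r ?mulr0 ?addr0.
by have [-> dE] := transition_cst tg Sx; split=> [|k]; rewrite ?dE ?mul0r mulr0 ?addr0.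
Qed.

Lemma transition1M L L' S S' f g :
    transition L S 1 f -> transition L' S' 1 g ->
  transition (L + L') (S `|` S') 1 (fun x => f x * g x).
Proof.
move=> tf tg; apply: (transition_mul_aux tf tg) => x /not_orP[Sx S'x].
have [-> dE] := transition_cst tf Sx; have [-> dE'] := transition_cst tg S'x.
by split=> [|k]; rewrite ?dE ?dE' ?mulr0 ?addr0 ?mulr1.
Qed.

Lemma transitionC L S f :
  transition L S 0 f -> transition L S 1 (fun x => 1 - f x).
Proof.
move=> tf.
have E : (fun x => 1 - f x) = (fun x => 1 + (-1) * f x).
  by apply/funext => x; rewrite mulN1r.
have dE k x : pderiv k (fun x => 1 - f x) x = - pderiv k f x.
  rewrite /pderiv (_ : (fun x => 1 - f x) = cst 1 - f)//.
  rewrite deriveB; first by rewrite derive_cst sub0r.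
    exact: derivable_cst.
  by apply: Ck_derivable => n; exact: transition_Ck tf n.
split.
- move=> n; rewrite E; apply: CkD; first exact: Ck_cst.
  by apply: CkM; [exact: Ck_cst|exact: transition_Ck tf n].
- by move=> x; have := transition_itv tf x; lra.
- by move=> k x; rewrite dE normrN; exact: transition_pderiv tf _ _.
- move=> x /(transition_cst tf)[-> d0]; rewrite subr0; split=> // k.
  by rewrite dE d0 oppr0.
Qed.

(** L0 is fixed before the affine function, so slopes of order m give gradients of order m. *)
Lemma transition_step : exists2 L0 : R, 0 <= L0 & forall al be ga C : R,
  `|al| <= C -> `|be| <= C ->
  transition (L0 * C) [set x | aff al be ga x < 1] 0
    (fun x => step (aff al be ga x)).
Proof.
have [L0 L00 HL] := @dstep_bounded R; exists L0 => // al be ga C aC bC.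
have dE k x : pderiv k (fun x => step (aff al be ga x)) x =
    dstep (aff al be ga x) * (al * (basis_vec k).1 + be * (basis_vec k).2).
  have /is_derive_comp1 := is_derive_aff al be ga x (basis_vec k).
  by move=> /(_ _ _ (is_derive_step _))[_ <-].
split.
- by move=> n; apply: Ck_step; exact: Ck_aff.
- by move=> x; exact: step_itv.
- move=> k x; rewrite dE normrM ler_pM//.
  rewrite /basis_vec/=; case: k {dE} => -[|[|//]] i /=.
    by rewrite mulr1 mulr0 addr0.
  by rewrite mulr1 mulr0 add0r.
- move=> x /negP; rewrite -leNgt => u1; split=> [|k]; first exact: step_ge1.
  by rewrite dE dstep_ge1// mul0r.
Qed.

End Transition.

(** * Cutoffs near a segment *)

Section EdgeCutoff.
Context {R : realType}.
Local Notation R2 := (measurableTypeR R * measurableTypeR R)%type.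
Local Notation mu := (lebesgue2 R).
Implicit Types (a b x : R * R).

Definition tile (p : R * R) (r : R) : set (R * R) :=
  `[p.1 - r, p.1 + r]%classic `*` `[p.2 - r, p.2 + r]%classic.

Lemma tileP p r x : tile p r x <-> `|x - p| <= r.
Proof.
rewrite norm_pair_le /= !ler_distl; split.
  by move=> [/=]; rewrite !in_itv/= => -> ->.
by move=> /andP[xM yM]; split; rewrite /= in_itv.
Qed.

Lemma measurable_tile p r : measurable (tile p r : set R2).
Proof. by apply: measurableX; exact: measurable_itv. Qed.

Lemma lebesgue2_tile p r : 0 <= r -> mu (tile p r) = (4 * r ^+ 2)%:E.
Proof. by move=> r0; rewrite lebesgue2_rect; [congr EFin; ring|lra|lra]. Qed.

(** Squares centred at n + 1 equally spaced points cover a tube around a slanted segment; with r of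
    order 1/n their total area is O(1/n), by subadditivity alone. *)
Definition chain a b (n : nat) (r : R) : set (R * R) :=
  \bigcup_(j in `I_n.+1) tile (spoint a b (j%:R / n%:R)) r.

Lemma measurable_chain a b n r : measurable (chain a b n r : set R2).
Proof. by apply: bigcup_measurable => j _; exact: measurable_tile. Qed.

Lemma lebesgue2_chain a b n r : 0 <= r ->
  (mu (chain a b n r) <= (n.+1%:R * (4 * r ^+ 2))%:E)%E.
Proof.
move=> r0.
have mt (j : nat) : (j < n.+1)%N ->
    measurable (tile (spoint a b (j%:R / n%:R)) r : set R2).
  by move=> _; exact: measurable_tile.
rewrite /chain bigcup_mkord; apply: (le_trans (Boole_inequality mu mt)).
rewrite (eq_bigr (fun=> (4 * r ^+ 2)%:E)) => [|j _]; last exact: lebesgue2_tile.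
by rewrite sumEFin sumr_const card_ord -[X in (X%:E <= _)%E]mulr_natl.
Qed.

Lemma chain_segment a b n r x : (0 < n)%N -> chain a b n r x ->
  exists2 y, segment a b y & `|x - y| <= r.
Proof.
move=> n0 [j /= jn] /tileP xr.
eexists; last exact: xr; exists (j%:R / n%:R) => //=.
by rewrite in_itv/= divr_ge0//= ler_pdivrMr ?ltr0n// mul1r ler_nat -ltnS.
Qed.

Lemma sub_chain a b n r x (t : R) : (0 < n)%N -> 0 <= t <= 1 ->
  `|x - spoint a b t| <= r -> chain a b n (r + `|b - a| / n%:R) x.
Proof.
move=> n0 /andP[t0 t1] xr; have n0' : (0 : R) < n%:R by rewrite ltr0n.
have tn0 : 0 <= t * n%:R by rewrite mulr_ge0.
have /andP[j1 j2] := Num.Theory.truncn_itv tn0.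
set j := Num.truncn _ in j1 j2.
have jn : (j < n.+1)%N.
  by rewrite ltnS -(ler_nat R) (le_trans j1)// ler_piMl.
exists j => //; apply/tileP.
rewrite (_ : x - _ = (x - spoint a b t) + (t - j%:R / n%:R) *: (b - a)); last first.
  by rewrite !spointE scalerBl !opprD !addrA subrK.
rewrite (le_trans (ler_normD _ _))// lerD// normrZ mulrC ler_wpM2l//.
rewrite ger0_norm ?subr_ge0 ?ler_pdivrMr//.
by rewrite lerBlDr -{1}[n%:R^-1]mul1r -mulrDl ler_pdivlMr// addrC natr1 ltW.
Qed.

Lemma edge_tube a b : a != b -> exists2 K : R, 0 <= K &
  forall (e : R) x, 0 <= e ->
    `|cross (b - a) (x - a)| <= e ->
    - e <= (b - a).1 * (x - a).1 + (b - a).2 * (x - a).2 <=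
      (b - a).1 ^+ 2 + (b - a).2 ^+ 2 + e ->
  exists2 t : R, 0 <= t <= 1 & `|x - spoint a b t| <= K * e.
Proof.
move=> ab; set d := b - a; set D := d.1 ^+ 2 + d.2 ^+ 2.
have D0 : 0 < D.
  rewrite lt_neqAle addr_ge0 ?sqr_ge0// andbT eq_sym.
  rewrite paddr_eq0 ?sqr_ge0// !sqrf_eq0; apply: contra ab => /andP[/eqP d1 /eqP d2].
  by rewrite eq_sym -subr_eq0 -/d; apply/eqP; rewrite [d]surjective_pairing d1 d2.
exists ((`|d.1| + `|d.2|) / D); first by rewrite divr_ge0 ?(ltW D0)// addr_ge0.
move=> e x e0; set l := cross d (x - a); set s := (_ + _) => le_l /andP[s1 s2].
pose t : R := Num.max 0 (Num.min 1 (s / D)).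
have t01 : 0 <= t <= 1 by rewrite /t le_max lexx/= ge_max ler01/= ge_min lexx.
have st : `|s / D - t| <= e / D.
  rewrite ler_distl /t.
  have s1' : - (e / D) <= s / D by rewrite -mulNr ler_pM2r ?invr_gt0.
  have s2' : s / D <= 1 + e / D.
    by rewrite ler_pdivrMr// mulrDl mul1r divfK ?gt_eqF.
  have eD : 0 <= e / D by rewrite divr_ge0// ltW.
  case: (leP 1 (s / D)) => h1; case: (leP 0 _) => h2; lra.
have lD : `|l / D| <= e / D.
  by rewrite normrM normfV (gtr0_norm D0) ler_pM2r ?invr_gt0.
exists t => //.
have -> : x - spoint a b t = ((s / D - t) * d.1 - l / D * d.2,
                             (s / D - t) * d.2 + l / D * d.1).
  rewrite spointE -/d /l /s /cross.
  have D0' : d.1 ^+ 2 + d.2 ^+ 2 != 0 by rewrite gt_eqF.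
  by congr (_, _) => /=; rewrite /D /GRing.scale/=; field.
rewrite -[leRHS]mulrA [D^-1 * e]mulrC norm_pair_le/=.
have P (u v p q : R) : `|u| <= e / D -> `|v| <= e / D ->
    `|u * p + v * q| <= (`|p| + `|q|) * (e / D).
  move=> ue ve; rewrite (le_trans (ler_normD _ _))// mulrDl !normrM.
  by rewrite lerD// mulrC ler_wpM2l.
apply/andP; split; first by rewrite -mulrN -(normrN d.2) P.
by rewrite (addrC `|d.1|) P.
Qed.

(** One constant for all the estimates, so that a union of two sets only adds constants. Vanishing
    in a neighbourhood of S, not just on S, is what later keeps supports inside Q. *)
Definition has_cutoffs (S : set (R * R)) := exists2 C : R, 0 <= C & forall m : nat,
  exists (N : R * R -> R) (T : set (R * R)),
  [/\ transition (C * m.+1%:R) T 1 N,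
      measurable (T : set R2), (mu T <= (C / m.+1%:R)%:E)%E,
      forall x, T x -> exists2 y, S y & `|x - y| <= C / m.+1%:R &
      forall x, S x -> \near x, N x = 0].

Lemma segment_cutoffs a b : a != b -> has_cutoffs (segment a b).
Proof.
move=> ab; have [K K0 tubeP] := edge_tube ab.
have [L0 L00 stepP] := @transition_step R.
set d := b - a; set D := d.1 ^+ 2 + d.2 ^+ 2.
(* [edge_tube] at e = 2/n puts x within 2K/n of the segment, and [sub_chain] adds |b - a|/n. Below,
   C1 counts four steps, and 8 r^2 bounds (m + 2) squares of area 4 (r/n)^2, up to a factor 1/n, as
   m + 2 <= 2n. *)
pose r := K * 2 + `|b - a|.
have r0 : 0 <= r by rewrite addr_ge0// mulr_ge0.
pose C1 := 4 * (L0 * (`|d.1| + `|d.2|)).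
have C10 : 0 <= C1 by rewrite !mulr_ge0// addr_ge0.
have C20 : 0 <= 8 * r ^+ 2 by rewrite mulr_ge0// sqr_ge0.
exists (C1 + r + 8 * r ^+ 2); first by rewrite addr_ge0// addr_ge0.
move=> m; set n : R := m.+1%:R.
have n0 : 0 < n by rewrite ltr0n.
(* Four half-planes bounding a strip about the segment: u1 and u2 limit the distance to its line, u3
   and u4 the overshoot past b and a. The offset -1 makes all four at most -1 on the segment, so
   every step is 1 in a neighbourhood of it. *)
pose u1 := aff (- n * d.2) (n * d.1) (n * (d.2 * a.1 - d.1 * a.2) - 1).
pose u2 := aff (n * d.2) (- n * d.1) (n * (d.1 * a.2 - d.2 * a.1) - 1).
pose u3 := aff (n * d.1) (n * d.2) (n * (- d.1 * a.1 - d.2 * a.2 - D) - 1).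
pose u4 := aff (- n * d.1) (- n * d.2) (n * (d.1 * a.1 + d.2 * a.2) - 1).
have u1E x : u1 x = n * cross d (x - a) - 1.
  by rewrite /u1 /aff /cross/=; ring.
have u2E x : u2 x = - n * cross d (x - a) - 1.
  by rewrite /u2 /aff /cross/=; ring.
have u3E x : u3 x = n * (d.1 * (x - a).1 + d.2 * (x - a).2 - D) - 1.
  by rewrite /u3 /aff/=; ring.
have u4E x : u4 x = - n * (d.1 * (x - a).1 + d.2 * (x - a).2) - 1.
  by rewrite /u4 /aff/=; ring.
have b1 : `|n * d.1| <= n * (`|d.1| + `|d.2|).
  by rewrite normrM gtr0_norm// ler_pM2l// lerDl.
have b2 : `|n * d.2| <= n * (`|d.1| + `|d.2|).
  by rewrite normrM gtr0_norm// ler_pM2l// lerDr.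
have b3 : `|- n * d.1| <= n * (`|d.1| + `|d.2|) by rewrite mulNr normrN.
have b4 : `|- n * d.2| <= n * (`|d.1| + `|d.2|) by rewrite mulNr normrN.
have T1 := stepP _ _ (n * (d.2 * a.1 - d.1 * a.2) - 1) _ b4 b1.
have T2 := stepP _ _ (n * (d.1 * a.2 - d.2 * a.1) - 1) _ b2 b3.
have T3 := stepP _ _ (n * (- d.1 * a.1 - d.2 * a.2 - D) - 1) _ b1 b2.
have T4 := stepP _ _ (n * (d.1 * a.1 + d.2 * a.2) - 1) _ b3 b4.
rewrite -/u1 in T1; rewrite -/u2 in T2; rewrite -/u3 in T3; rewrite -/u4 in T4.
have /transitionC := transition0M (transition0M T1 T2) (transition0M T3 T4).
set N := (fun x => 1 - _); set L := (_ + _); set S := (_ `&` _).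
move=> tN; pose T := chain a b m.+1 (r / n).
have ST : S `<=` T.
  move=> x [[/=]]; rewrite u1E u2E => h1 h2 [/=]; rewrite u3E u4E => h3 h4.
  have i1 : `|cross d (x - a)| <= 2 / n.
    by rewrite ler_norml -mulNr ler_pdivrMr// ler_pdivlMr//; apply/andP; lra.
  have i2 : - (2 / n) <= d.1 * (x - a).1 + d.2 * (x - a).2 <= D + 2 / n.
    rewrite -mulNr ler_pdivrMr// -lerBlDl ler_pdivlMr//; apply/andP; lra.
  have [|t t01 xt] := tubeP (2 / n) x _ i1 i2; first by rewrite divr_ge0// ltW.
  rewrite /T /r mulrDl -mulrA; exact: sub_chain xt.
exists N, T; split.
- apply: transition_sub ST _; apply: transition_le tN.
  rewrite (_ : L = C1 * n); last by rewrite /L /C1; ring.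
  by rewrite ler_pM2r// -addrA lerDl addr_ge0.
- exact: measurable_chain.
- apply: le_trans (lebesgue2_chain _ _ _ _) _; first by rewrite divr_ge0// ltW.
  rewrite lee_fin ler_pdivlMr// (@le_trans _ _ (8 * r ^+ 2))//; last first.
    by rewrite lerDr addr_ge0.
  rewrite expr_div_n (_ : _ * n = (m.+2%:R / n) * (4 * r ^+ 2)); last first.
    by field; rewrite gt_eqF.
  have mn : m.+2%:R / n <= 2.
    by rewrite ler_pdivrMr// /n -natrM ler_nat mul2n -addnn -addn1 leq_add2l.
  have r2 : 0 <= 4 * r ^+ 2 by rewrite mulr_ge0// sqr_ge0.
  by rewrite (le_trans (ler_wpM2r r2 mn))//; lra.
- move=> x /chain_segment -/(_ isT) [y ay xy]; exists y => //.
  rewrite (le_trans xy)// ler_pM2r ?invr_gt0//.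
  by rewrite addrAC lerDr addr_ge0.
- move=> x abx.
  have cu (u : R * R -> R) : continuous u -> u x < 0 -> \near x, u x < 0.
    by move=> cu ux; apply: (@cvgr_lt R _ (nbhs x) _ u (u x)) => //; exact: cu.
  have [t t01 xE] := abx; move: t01; rewrite /= in_itv/= => /andP[t0 t1].
  have dx : x - a = t *: d by rewrite -xE spointE addrAC subrr add0r.
  have c0 : cross d (x - a) = 0 by rewrite dx /cross/= /GRing.scale/=; ring.
  have sE : d.1 * (x - a).1 + d.2 * (x - a).2 = t * D.
    by rewrite dx /= /D /GRing.scale/=; ring.
  have D0 : 0 <= D by rewrite addr_ge0 ?sqr_ge0.
  have n1 : \near x, u1 x < 0.
    by apply: cu; [exact: (Ck_continuous (@Ck_aff _ 0 _ _ _))|rewrite u1E c0; lra].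
  have n2 : \near x, u2 x < 0.
    by apply: cu; [exact: (Ck_continuous (@Ck_aff _ 0 _ _ _))|rewrite u2E c0; lra].
  have n3 : \near x, u3 x < 0.
    apply: cu; [exact: (Ck_continuous (@Ck_aff _ 0 _ _ _))|rewrite u3E sE].
    have : n * (t * D - D) <= 0 by rewrite mulr_ge0_le0 ?(ltW n0)// subr_le0 ler_piMl.
    lra.
  have n4 : \near x, u4 x < 0.
    apply: cu; [exact: (Ck_continuous (@Ck_aff _ 0 _ _ _))|rewrite u4E sE].
    have : 0 <= n * (t * D) by rewrite !mulr_ge0// ltW.
    lra.
  near=> z; rewrite /N !step_le0 ?mulr1 ?subrr//; apply: ltW; near: z => //.
Unshelve. all: by end_near. Qed.

End EdgeCutoff.

(** * Cutoffs of the quadrilateral *)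

Section QuadCutoff.
Context {R : realType}.
Local Notation R2 := (measurableTypeR R * measurableTypeR R)%type.
Local Notation mu := (lebesgue2 R).
Implicit Types (a b x : R * R) (V : 'I_4 -> R * R).

Lemma has_cutoffsU (S S' : set (R * R)) :
  has_cutoffs S -> has_cutoffs S' -> has_cutoffs (S `|` S').
Proof.
move=> [C C0 HC] [C' C'0 HC']; exists (C + C'); first exact: addr_ge0.
move=> m; have [N [T [tN mT muT nT zN]]] := HC m.
have [N' [T' [tN' mT' muT' nT' zN']]] := HC' m.
have n0 : (0 : R) < m.+1%:R by rewrite ltr0n.
exists (fun x => N x * N' x), (T `|` T'); split.
- by rewrite mulrDl; exact: transition1M.
- exact: measurableU.
- rewrite (le_trans (measureU2 _ _ _))// mulrDl EFinD.
  exact: leeD.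
- move=> x [/nT|/nT'] [y Sy xy]; exists y; [by left| |by right|].
    by rewrite (le_trans xy)// ler_pM2r ?invr_gt0// lerDl.
  by rewrite (le_trans xy)// ler_pM2r ?invr_gt0// lerDr.
- move=> x [/zN|/zN']; apply: filterS => y ->; first by rewrite mul0r.
  by rewrite mulr0.
Qed.

(** A common value of V i and V (i + 1) would lie on the edges i - 1 and i + 1, which are opposite
    and so disjoint. *)
Lemma simple_polygon_neq V i : simple_polygon V -> V i != V (i + 1).
Proof.
move=> sV; apply/negP => /eqP Vi.
have [_ /seteqP[+ _]] := sV (i - 1).
move/(_ (V i)); apply; split.
  exists 1; first by rewrite /= in_itv/= lexx ler01.
  by rewrite /spoint subrr scale0r add0r scale1r subrK.
exists 0; first by rewrite /= in_itv/= lexx ler01.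
rewrite /spoint subr0 scale1r scale0r addr0 Vi; congr V.
by rewrite -addrA; congr (_ + _); exact: val_inj.
Qed.

Lemma boundary_cutoffs V : simple_polygon V -> has_cutoffs (boundary V).
Proof.
move=> sV; rewrite boundaryE.
by do !apply: has_cutoffsU; apply: segment_cutoffs; exact: simple_polygon_neq.
Qed.

(** The boundary cutoff N is kept inside Q and replaced by 0 elsewhere. As N vanishes near the
    boundary, the result is locally N or locally 0, hence smooth with support inside Q. *)
Lemma quad_cutoffs V : simple_polygon V ->
  exists2 C : R, 0 <= C & forall m : nat, exists (eta : R * R -> R) (T : set (R * R)),
  [/\ test_function (open_quad V) eta,
      (forall x, 0 <= eta x <= 1) /\
      (forall k x, `|pderiv k eta x| <= C * m.+1%:R),
      measurable (T : set R2) /\ (mu T <= (C / m.+1%:R)%:E)%E,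
      forall x, T x -> exists2 y, boundary V y & `|x - y| <= C / m.+1%:R &
      forall x, open_quad V x -> ~ T x ->
        eta x = 1 /\ forall k, pderiv k eta x = 0].
Proof.
move=> /boundary_cutoffs[C C0 HC]; exists C => // m.
have [N [T [tN mT muT nT zN]]] := HC m.
pose W := open_quad V.
pose eta x := if `[< W x >] then N x else 0.
have etaW x : W x -> \near x, eta x = N x.
  move=> Wx; have := open_open_quad (V := V).
  rewrite openE => /(_ x Wx); apply: filterS => y Wy.
  by rewrite /eta; case: asboolP.
have eta0 x : ~ W x -> \near x, eta x = 0.
  move=> Wx; have [Bx|Bx] := pselect (boundary V x).
    by apply: filterS (zN x Bx) => y Ny; rewrite /eta; case: ifP.
  apply: filterS (near_open_quadE Bx) => y [Wy _].
  by rewrite /eta; case: asboolP => // /Wy.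
have etaE x : (\near x, eta x = N x) \/ (\near x, eta x = 0).
  by have [/etaW|/eta0] := pselect (W x); [left|right].
have d0 k x : (\near x, eta x = 0) -> pderiv k eta x = 0.
  move=> e0; rewrite /pderiv (@near_eq_derive _ _ _ _ (fun=> 0) _ _ e0).
  exact: derive_cst.
have cl0 x : closure [set y | eta y != 0] x -> W x.
  move=> clx; apply: contrapT => /eta0 Wx.
  by have [y /= [/eqP + ey]] := clx _ Wx.
exists eta, T; split => //.
- split.
  + move=> n; apply: Ck_local => x; have [ex|ex] := etaE x.
      by exists N => //; exact: transition_Ck tN n.
    by exists (fun=> 0) => //; exact: Ck_cst.
  + have [M WM] := open_quad_bounded V.
    apply: (@subclosed_compact _ _ (square M)).
    - exact: closed_closure.
    - exact: compact_square.
    by move=> x /cl0 /WM /squareP.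
  + exact: cl0.
- split=> [x|k x].
    by rewrite /eta; case: ifP => _; [exact: transition_itv tN x|rewrite lexx ler01].
  have [ex|ex] := etaE x; last by rewrite d0// normr0 mulr_ge0.
  rewrite /pderiv (near_eq_derive _ ex).
  exact: transition_pderiv tN k x.
- move=> x Wx Tx; have [N1 dN] := transition_cst tN Tx.
  split=> [|k]; first by rewrite /eta; case: asboolP.
  by rewrite /pderiv (near_eq_derive _ (etaW x Wx)); exact: dN.
Qed.

End QuadCutoff.

(** * Integration and square-integrability *)

Section IntegrationLemmas.
Context d (T : measurableType d) (R : realType).
Variable mu : {measure set T -> \bar R}.
Implicit Types (D : set T) (f g : T -> R).

Lemma cvg_Rintegral_dominated D (f_ : nat -> T -> R) f g : measurable D ->
    (forall n, measurable_fun D (f_ n)) -> measurable_fun D f ->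
    (forall x, D x -> f_ n x @[n --> \oo] --> f x) ->
    mu.-integrable D (EFin \o g) ->
    (forall n x, D x -> `|f_ n x| <= g x) ->
  \int[mu]_(x in D) f_ n x @[n --> \oo] --> \int[mu]_(x in D) f x.
Proof.
move=> mD mf_ mf ff ig fg.
have mEf_ n : measurable_fun D (EFin \o f_ n) by exact: measurableT_comp.
have mEf : measurable_fun D (EFin \o f) by exact: measurableT_comp.
have [|| fi _ ffi] := @dominated_convergence _ _ _ mu D mD
  (fun n => EFin \o f_ n) (EFin \o f) (EFin \o g) mEf_ mEf _ ig.
- apply: aeW => x Dx; apply: cvg_EFin; first exact: nearW.
  exact: ff.
- by apply: aeW => x Dx n; rewrite /= lee_fin; exact: fg.
rewrite /Rintegral; apply: fine_cvg; rewrite fineK; last exact: integrable_fin_num.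
exact: ffi.
Qed.

Lemma integrable_mul_bounded D f g (B : R) : measurable D ->
    mu.-integrable D (EFin \o f) -> measurable_fun D g ->
    (forall x, `|g x| <= B) ->
  mu.-integrable D (EFin \o (fun x => f x * g x)).
Proof.
move=> mD fi mg gB.
have bg : [bounded g x | x in D].
  by exists B; split=> [|B' BB' x _]; [exact: num_real|exact: le_trans (gB x) (ltW BB')].
have := integrableMl mD fi mg bg; apply: eq_integrable => // x _.
Qed.

Lemma ae_eq_Rintegral D f g : measurable D -> measurable_fun D f ->
    measurable_fun D g -> {ae mu, forall x, D x -> f x = g x} ->
  \int[mu]_(x in D) f x = \int[mu]_(x in D) g x.
Proof.
move=> mD mf mg fg; rewrite /Rintegral; congr fine; apply: ae_eq_integral => //.
- exact: measurableT_comp.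
- exact: measurableT_comp.
- by apply: filterS fg => x fgx Dx /=; rewrite fgx.
Qed.

End IntegrationLemmas.

Section L2.
Context {R : realType}.
Local Notation R2 := (measurableTypeR R * measurableTypeR R)%type.
Local Notation mu := (lebesgue2 R).
Implicit Types (W : set (R * R)) (u v : R * R -> R).

Lemma in_L2_measurable W u : measurable (W : set R2) -> in_L2 W u ->
  measurable_fun (W : set R2) u.
Proof.
move=> mW /sub_Lfun_mfun; rewrite inE/= => mu'.
by apply/(measurable_restrictT _ mW).
Qed.

Lemma in_L2_mul W u v : measurable (W : set R2) -> in_L2 W u -> in_L2 W v ->
  mu.-integrable W (EFin \o (fun x => u x * v x)).
Proof.
move=> mW Lu Lv; have /Lfun1_integrable := Lfun2_mul_Lfun1 Lu Lv.
move=> H; apply/(integrable_mkcond _ mW); apply: eq_integrable H => // x _ /=.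
by rewrite !patchE; case: ifP => //= _; rewrite mul0r.
Qed.

(** The majorant is u^2 + 1, integrable on a set of finite measure. *)
Lemma in_L2_integrable W u : measurable (W : set R2) -> (mu W < +oo)%E ->
  in_L2 W u -> mu.-integrable W (EFin \o u).
Proof.
move=> mW Wfin Lu.
have sq := in_L2_mul mW Lu Lu.
have one : mu.-integrable W (EFin \o (fun=> 1 : R)).
  by apply/integrableP; split; [exact: measurable_cst|
    under eq_integral do rewrite /= normr1; rewrite integral_cst// mul1e].
have H : mu.-integrable W (fun x => ((u x * u x)%:E + 1%:E)%E).
  exact: integrableD.
apply: le_integrable H => //.
  by apply: measurableT_comp => //; exact: in_L2_measurable.
move=> x _ /=; rewrite lee_fin.
rewrite [leRHS]ger0_norm ?addr_ge0 -?expr2 ?sqr_ge0//.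
have := sqr_ge0 (`|u x| - 1); have := sqr_ge0 (u x).
rewrite -(real_normK (num_real (u x))).
by nra.
Qed.

Lemma in_L2D W u v : in_L2 W u -> in_L2 W v -> in_L2 W (fun x => u x + v x).
Proof.
rewrite /in_L2 => Lu Lv.
rewrite (_ : _ \_ W = u \_ W + v \_ W).
  have [_ aC] := @Lfun_addr_closed _ _ _ mu 2%:E (lee1n 2).
  exact: aC.
apply/funext => x; rewrite !patchE /=.
by rewrite [RHS]/GRing.add/= !patchE; case: ifP => //; rewrite addr0.
Qed.

Lemma in_L2Z W (c : R) u : in_L2 W u -> in_L2 W (fun x => c * u x).
Proof.
rewrite /in_L2 => Lu.
rewrite (_ : _ \_ W = c \o* (u \_ W)).
  by apply: Lfun_scale => //; exact: ler1n.
apply/funext => x; rewrite /= !patchE.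
by case: ifP => _; [rewrite mulrC|rewrite /point/= ?mul0r ?mulr0].
Qed.

End L2.

(** * Test functions *)

Section WeakGradientTheory.
Context {R : realType}.
Local Notation R2 := (measurableTypeR R * measurableTypeR R)%type.
Local Notation mu := (lebesgue2 R).
Implicit Types (W : set (R * R)) (u v w eta : R * R -> R) (V : 'I_4 -> R * R).

Lemma continuous_supported_bounded u M : continuous u -> supported M u ->
  exists B, forall x, `|u x| <= B.
Proof.
move=> cu su; have cus : compact (u @` square M).
  apply: continuous_compact; last exact: compact_square.
  exact: continuous_subspaceT.
have [B [_ uB]] := compact_bounded cus.
exists (`|B| + 1) => x.
have [Mx|/squareP sx] := ltP M `|x|; first by rewrite su// normr0 addr_ge0.
by apply: uB; [rewrite (le_lt_trans (ler_norm B)) ?ltrDl|exists x].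
Qed.

Lemma test_supported W eta : test_function W eta -> exists M, supported M eta.
Proof.
move=> [_ ceta _]; have [M [_ HM]] := compact_bounded ceta.
exists (M + 1) => x Mx; apply/eqP; apply: contraPT Mx => ex.
apply/negP; rewrite -leNgt; apply: HM; first by rewrite ltrDl.
by apply: subset_closure.
Qed.

Lemma test_pderiv_continuous W eta k : test_function W eta ->
  continuous (pderiv k eta).
Proof. by move=> [Ceta _ _]; have [_ /(_ k)[_ []]] := Ceta 1%N. Qed.

Lemma test_continuous W eta : test_function W eta -> continuous eta.
Proof. by move=> [Ceta _ _]; have [] := Ceta 0%N. Qed.

Lemma test_bounded W eta : test_function W eta ->
  exists B, forall x, `|eta x| <= B.
Proof.
move=> te; have [M sM] := test_supported te.
exact: continuous_supported_bounded (test_continuous te) sM.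
Qed.

Lemma test_pderiv_bounded W eta k : test_function W eta ->
  exists B, forall x, `|pderiv k eta x| <= B.
Proof.
move=> te; have [M sM] := test_supported te.
apply: (@continuous_supported_bounded _ M); first exact: test_pderiv_continuous te.
exact: supported_pderiv.
Qed.

Lemma test_eq0 W eta x : test_function W eta -> ~ W x ->
  eta x = 0 /\ forall k, pderiv k eta x = 0.
Proof.
move=> [_ _ sW] Wx.
have ncl : (~` closure [set y | eta y != 0]) x by move=> /sW.
have e0 : \near x, eta x = 0.
  have : nbhs x (~` closure [set y | eta y != 0]).
    by apply: open_nbhs_nbhs; split => //; exact/closed_openC/closed_closure.
  apply: filterS => y ney; apply/eqP; apply: contra_notT ney => ey.
  exact: subset_closure.
split=> [|k]; first exact: nbhs_singleton e0.
rewrite /pderiv (@near_eq_derive _ _ _ _ (fun=> 0) _ _ e0).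
exact: derive_cst.
Qed.

Lemma test_functionM W eta u : test_function W eta -> (forall n, Ck n u) ->
  test_function W (fun x => eta x * u x).
Proof.
move=> [Ceta ceta sW] Cu.
have sub : closure [set x | eta x * u x != 0] `<=` closure [set x | eta x != 0].
  by apply: closureS => x /=; apply: contra => /eqP ->; rewrite mul0r.
split.
- by move=> n; apply: CkM.
- by apply: subclosed_compact sub => //; exact: closed_closure.
- exact: subset_trans sub sW.
Qed.

Lemma integrable_test W u eta : measurable (W : set R2) ->
    mu.-integrable W (EFin \o u) -> test_function W eta ->
  mu.-integrable W (EFin \o (fun x => u x * eta x)).
Proof.
move=> mW ui te; have [B etaB] := test_bounded te.
apply: (@integrable_mul_bounded _ _ _ mu W u eta B) => //.
by apply: measurable_funTS; apply: continuous_measurable2; exact: (test_continuous te).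
Qed.

Lemma integrable_test_pderiv W u eta k : measurable (W : set R2) ->
    mu.-integrable W (EFin \o u) -> test_function W eta ->
  mu.-integrable W (EFin \o (fun x => u x * pderiv k eta x)).
Proof.
move=> mW ui te; have [B etaB] := test_pderiv_bounded k te.
apply: (@integrable_mul_bounded _ _ _ mu W u (pderiv k eta) B) => //.
apply: measurable_funTS; apply: continuous_measurable2.
exact: (test_pderiv_continuous te).
Qed.

(** The product of the affine function with eta has bounded support, so its derivative integrates to
    0 over the plane; eta vanishes off W together with its gradient, so W may replace the plane. *)
Lemma aff_by_parts W (al be ga : R) eta k : measurable (W : set R2) ->
    (mu W < +oo)%E -> test_function W eta ->
  \int[mu]_(x in W) (aff al be ga x * pderiv k eta x) =
  - ((al * (basis_vec k).1 + be * (basis_vec k).2) * \int[mu]_(x in W) eta x).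
Proof.
move=> mW Wfin te; set c := (X in X * _).
have [Ceta _ _] := te; have [_ /(_ k)[deta Cdeta]] := Ceta 1%N.
have [_ /(_ k)[daff _]] := @Ck_aff _ 1%N al be ga.
have dE : pderiv k (aff al be ga) = fun=> c.
  apply/funext => x; rewrite /pderiv.
  by have [_ ->] := is_derive_aff al be ga x (basis_vec k).
pose f x := aff al be ga x * eta x.
have fE : pderiv k f = fun x => aff al be ga x * pderiv k eta x + eta x * c.
  by rewrite /f (pderivM daff deta) dE.
have caff := Ck_continuous (@Ck_aff R 0%N al be ga).
have ceta := test_continuous te.
have cdeta := test_pderiv_continuous (k := k) te.
have cf : continuous f by move=> x; apply: cvgM; [exact: caff|exact: ceta].
have c1 : continuous (fun x => aff al be ga x * pderiv k eta x).
  by move=> x; apply: cvgM; [exact: caff|exact: cdeta].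
have c2 : continuous (fun x => eta x * c).
  by move=> x; apply: cvgM; [exact: ceta|exact: cvg_cst].
have [M sM] := test_supported te.
have s1 : supported M (fun x => aff al be ga x * pderiv k eta x).
  by move=> x Mx; rewrite (supported_pderiv k sM Mx) mulr0.
have s2 : supported M (fun x => eta x * c) by move=> x Mx; rewrite sM ?mul0r.
have f0 : \int[mu]_x pderiv k f x = 0.
  apply: (@integral_pderiv_supported _ _ _ M).
  - exact: cf.
  - by move=> x; apply: derivableM.
  - by rewrite fE => x; apply: cvgD; [exact: c1|exact: c2].
  - by move=> x Mx; rewrite /f sM ?mulr0.
have toT (g : R * R -> R) : (forall x, ~ W x -> g x = 0) ->
    \int[mu]_(x in W) g x = \int[mu]_x g x.
  move=> g0; rewrite Rintegral_mkcond; congr (Rintegral _ _ _).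
  apply/funext => x; rewrite patchE; case: ifPn => //.
  by rewrite notin_setE => /g0.
rewrite !toT.
- have i1 := continuous_supported_integrable c1 s1.
  have i2 := continuous_supported_integrable c2 s2.
  have i3 := continuous_supported_integrable ceta sM.
  move: f0; rewrite fE RintegralD// RintegralZr// => /eqP.
  by rewrite addr_eq0 => /eqP ->; rewrite mulrC.
- by move=> x /(test_eq0 te)[].
- by move=> x /(test_eq0 te)[_ ->]; rewrite mulr0.
Qed.

End WeakGradientTheory.

(** * Uniqueness of weak gradients *)

Section Variations.
Context {R : realType}.
Local Notation R2 := (measurableTypeR R * measurableTypeR R)%type.
Local Notation mu := (lebesgue2 R).
Implicit Types (f g u : R * R -> R) (V : 'I_4 -> R * R).

(** The sets over which f integrates to 0 form a Dynkin system: the vanishing total integral handles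
    complements, integrability handles disjoint unions. *)
Lemma quadrant_ae0 (f : R2 -> R) : mu.-integrable setT (EFin \o f) ->
    (\int[mu]_x (f x)%:E = 0)%E ->
    (forall S, quadrants S -> \int[mu]_(x in S) (f x)%:E = 0)%E ->
  {ae mu, forall x, f x = 0}.
Proof.
move=> fi f0 fQ.
have mf : measurable_fun setT (EFin \o f) := measurable_int _ fi.
have P : forall S, <<s @quadrants R >> S -> (\int[mu]_(x in S) (f x)%:E = 0)%E.
  apply: (dynkin_induction (measurable_quadrants (R := R))) => //.
  - exact: setI_closed_quadrants.
  - move=> S mS fS; move: f0.
    rewrite -(setUv S) (@integral_setU _ _ _ mu S (~` S)) ?setUv//.
    + by rewrite fS add0e.
    + exact: measurableC.
    + by rewrite disj_set2E setICr.
  - move=> F mF tF fF; rewrite integral_bigcup//.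
      by apply: eseries0 => i _ _; exact: fF.
    by apply: (integrableS _ _ _ fi) => //; exact: bigcup_measurable.
have : ae_eq mu setT (EFin \o f) (cst 0%E).
  apply: integral_ae_eq => // E _ mE; rewrite integral0; apply: P.
  by rewrite -measurable_quadrants.
by apply: filterS => x /(_ I) [].
Qed.

Lemma flat0_le1 (t : R) : flat 0 t <= 1.
Proof.
rewrite /flat; case: ifPn => // t0.
by rewrite expr0 mul1r expR_le1 oppr_le0 invr_ge0 ltW.
Qed.

Lemma cvg_flat0 (s : R) :
  flat 0 (n.+1%:R * s) @[n --> \oo] --> (if 0 < s then 1 else 0 : R).
Proof.
case: ifPn => s0; last first.
  rewrite (_ : (fun n => _) = fun=> 0); first exact: cvg_cst.
  by apply/funext => n; rewrite flat_le0// pmulr_rle0// leNgt.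
rewrite (_ : (fun n => _) = fun n : nat => expR (- s^-1 * n.+1%:R^-1)).
  have h : - s^-1 * n.+1%:R^-1 @[n --> \oo] --> (0 : R).
    rewrite -(mulr0 (- s^-1)); apply: cvgM; first exact: cvg_cst.
    exact: cvg_harmonic.
  have := @cvg_comp _ _ _ (fun n : nat => - s^-1 * n.+1%:R^-1) expR _ _ _ h
    (@continuous_expR R 0).
  by rewrite expR0.
by apply/funext => n; rewrite /flat pmulr_rgt0// s0 expr0 mul1r invfM mulNr mulrC.
Qed.

(** No support condition is put on u because f will be a function times a cutoff. The constant u = 1
    gives the total integral, and dominated convergence the integrals over quadrants. *)
Lemma smooth_orthogonal_ae0 (f : R2 -> R) : mu.-integrable setT (EFin \o f) ->
    (forall u, (forall n, Ck n u) -> (forall x, 0 <= u x <= 1) ->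
      \int[mu]_x (f x * u x) = 0) ->
  {ae mu, forall x, f x = 0}.
Proof.
move=> fi fu.
have mf : measurable_fun setT f by apply/measurable_EFinP; exact: measurable_int fi.
have toE (S : set R2) : measurable S -> \int[mu]_(x in S) f x = 0 ->
    (\int[mu]_(x in S) (f x)%:E = 0)%E.
  move=> mS; rewrite /Rintegral => H.
  rewrite -[LHS]fineK ?H//; apply: integrable_fin_num => //.
  exact: integrableS fi.
apply: quadrant_ae0 => //.
  apply: toE => //; have := fu (fun=> 1) (fun n => Ck_cst n 1).
  under eq_Rintegral do rewrite mulr1.
  by apply=> x; rewrite ler01 lexx.
move=> _ [a [b ->]]; set S := _ `*` _.
have mS : measurable (S : set R2) by apply: measurableX; exact: measurable_itv.
apply: toE => //.
pose u (n : nat) (x : R * R) : R :=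
  flat 0 (aff n.+1%:R 0 (- (n.+1%:R * a)) x) *
  flat 0 (aff 0 n.+1%:R (- (n.+1%:R * b)) x).
have Cu n m : Ck m (u n) by apply: CkM; apply: Ck_flat; exact: Ck_aff.
have u01 n x : 0 <= u n x <= 1.
  by rewrite /u mulr_ge0 ?flat_ge0//= mulr_ile1 ?flat_ge0 ?flat0_le1.
have cv : \int[mu]_x (f x * u n x) @[n --> \oo] --> \int[mu]_x ((f \_ S) x).
  apply: (@cvg_Rintegral_dominated _ _ _ mu setT _ _ (fun x => `|f x|)) => //.
  - move=> n; apply: measurable_funM => //; apply: continuous_measurable2.
    exact: (Ck_continuous (Cu n 0%N)).
  - by apply/(measurable_restrictT _ mS); exact: measurable_funTS.
  - move=> x _.
    have -> : (f \_ S) x = f x * ((if 0 < x.1 - a then 1 else 0) *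
                                 (if 0 < x.2 - b then 1 else 0)).
      rewrite patchE; have [|] := asboolP (S x) => Sx.
        rewrite mem_set//; move: Sx => [/=]; rewrite !in_itv/= !andbT => h1 h2.
        by rewrite !subr_gt0 h1 h2 !mulr1.
      rewrite memNset//; move: Sx; rewrite /S/= !in_itv/= !andbT !subr_gt0.
      by case: ifP => h1; case: ifP => h2; rewrite ?mulr0 ?mul0r ?mulr0// => -[].
    apply: cvgM; first exact: cvg_cst.
    rewrite (_ : (fun n => u n x) = fun n =>
      flat 0 (n.+1%:R * (x.1 - a)) * flat 0 (n.+1%:R * (x.2 - b))).
      by apply: cvgM; exact: cvg_flat0.
    by apply/funext => n; rewrite /u /aff; congr (flat 0 _ * flat 0 _); ring.
  - exact: (integrable_abse fi).
  - move=> n x _; have /andP[u0 u1] := u01 n x.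
    by rewrite normrM (ger0_norm u0) ler_piMr.
rewrite Rintegral_mkcond.
have E0 : (fun n => \int[mu]_x (f x * u n x)) = fun=> 0.
  by apply/funext => n; apply: fu => //; exact: Cu.
rewrite E0 in cv.
exact: (cvg_unique _ cv (cvg_cst _)).
Qed.

Lemma measurable_open_quad V : measurable (open_quad V : set R2).
Proof. by apply: open_measurable2; exact: open_open_quad. Qed.

Lemma lebesgue2_open_quad V : (mu (open_quad V) < +oo)%E.
Proof.
have [M WM] := open_quad_bounded V.
apply: le_lt_trans (lebesgue2_square M); apply: le_measure; rewrite ?inE.
- exact: measurable_open_quad.
- exact: measurable_square.
- by move=> x /WM /squareP.
Qed.

Lemma boundary_dist V x : ~ boundary V x ->
  exists2 e : R, 0 < e & forall y, boundary V y -> e <= `|x - y|.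
Proof.
move=> Vx; have : nbhs x (~` boundary V).
  by apply: open_nbhs_nbhs; split => //; exact/closed_openC/closed_boundary.
move=> /nbhs_ballP[e /= e0 xeV]; exists e => // y Vy; rewrite leNgt.
by apply/negP => xy; apply: (xeV y) => //; rewrite -ball_normE.
Qed.

Lemma small_inv (C e : R) : 0 <= C -> 0 < e ->
  \forall m \near \oo, C / m.+1%:R < e.
Proof.
move=> C0 e0.
have h : C / n.+1%:R @[n --> \oo] --> (0 : R).
  rewrite -(mulr0 C); apply: cvgM; first exact: cvg_cst.
  exact: cvg_harmonic.
exact: (cvgr_lt _ h).
Qed.

(** The fundamental lemma of the calculus of variations. Each g eta_m vanishes almost everywhere,
    off one null set common to all m, and at a given interior point eta_m is 1 for m large. *)
Lemma open_quad_ae0 V g : simple_polygon V ->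
    mu.-integrable (open_quad V) (EFin \o g) ->
    (forall eta, test_function (open_quad V) eta ->
      \int[mu]_(x in open_quad V) (g x * eta x) = 0) ->
  {ae mu, forall x, open_quad V x -> g x = 0}.
Proof.
move=> sV gi g0; have mW := measurable_open_quad V.
have [C C0 HC] := quad_cutoffs sV.
have [eta etaP] := choice HC.
pose f m : R2 -> R := (fun x => g x * eta m x) \_ (open_quad V).
have f0 m : {ae mu, forall x, f m x = 0}.
  have [T [te _ _ _ _]] := etaP m.
  apply: smooth_orthogonal_ae0.
    have := integrable_test mW gi te => /(integrable_mkcond _ mW).
    apply: eq_integrable => // x _ /=.
    by rewrite /f !patchE; case: ifP.
  move=> u Cu _; rewrite -(g0 _ (test_functionM te Cu)).
  rewrite [RHS]Rintegral_mkcond; congr (Rintegral _ _ _); apply/funext => x.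
  by rewrite /f !patchE; case: ifP => _; rewrite ?mulrA// mul0r.
have fall : {ae mu, forall x m, f m x = 0}.
  exact/ae_foralln.
apply: filterS fall => x fx Wx.
have [e e0 xe] := boundary_dist Wx.1.
have [m _ Hm] := small_inv C0 e0.
have {}Hm := Hm m (leqnn m).
have [T [_ _ _ nT T1]] := etaP m.
have nTx : ~ T x.
  by move=> /nT[y Vy]; apply/negP; rewrite -ltNge (lt_le_trans Hm)// xe.
have [eta1 _] := T1 x Wx nTx.
by have := fx m; rewrite /f patchE mem_set// eta1 mulr1.
Qed.

End Variations.

(** * The mean gradient *)

Section MeanGradient.
Context {R : realType}.
Local Notation R2 := (measurableTypeR R * measurableTypeR R)%type.
Local Notation mu := (lebesgue2 R).
Implicit Types (w h : R * R -> R) (V : 'I_4 -> R * R).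

(** Compactness of the boundary turns the pointwise limits of w there into one radius r. *)
Lemma boundary_small V w (d : R) : {within quad V, continuous w} ->
    (forall y, boundary V y -> w y = 0) -> 0 < d ->
  exists2 r : R, 0 < r & forall x y, quad V x -> boundary V y ->
    `|x - y| < r -> `|w x| <= d.
Proof.
move=> cw w0 d0.
have cov := (compact_near_coveringP (boundary V)).1 (@compact_boundary _ V).
pose P (r : R) (y : R * R) := forall x, quad V x -> `|x - y| < r -> `|w x| <= d.
have [|e /= e0 He] := cov R (0 : R)^'+ P _.
  move=> y Vy.
  have /subspace_continuousP cwq := cw.
  have cwy : w @ within (quad V) (nbhs y) --> (0 : R).
    by rewrite -(w0 y Vy); apply: cwq; right.
  have /cvgr0_norm_le/(_ d d0) := cwy; rewrite /within/= => /nbhs_ballP[s /= s0 Hs].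
  have s2 : 0 < s / 2 by rewrite divr_gt0.
  (* Half of s for the displacement of the boundary point and half for r: the triangle inequality
     then puts x within s of y. *)
  exists (ball y (s / 2), [set r | r < s / 2]).
    by split=> /=; [exact: nbhsx_ballx|exact: nbhs_right_lt].
  move=> [y' r] [/= yy' rs] x qx xy'; apply: Hs => //.
  rewrite -ball_normE/= in yy' *.
  rewrite (le_lt_trans (ler_distD y' _ _))// [ltRHS]splitr ltrD// distrC.
  exact: lt_trans rs.
exists (e / 2); first by rewrite divr_gt0.
move=> x y qx Vy; apply: (He (e / 2)) => //=.
  by rewrite sub0r normrN gtr0_norm ?divr_gt0// ltr_pdivrMr// ltr_pMr// ltr1n.
by rewrite divr_gt0.
Qed.

Lemma norm_Rintegral_le (W T : set R2) (f : R2 -> R) (B c : R) :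
    measurable W -> measurable T -> mu.-integrable W (EFin \o f) ->
    (mu T <= c%:E)%E -> 0 <= B ->
    (forall x, W x -> ~ T x -> f x = 0) ->
    (forall x, W x -> T x -> `|f x| <= B) ->
  `|\int[mu]_(x in W) f x| <= B * c.
Proof.
move=> mW mT fi Tc B0 f0 fB.
have mWT : measurable (W `&` T) by exact: measurableI.
have fWT : mu.-integrable (W `&` T) (EFin \o f).
  by apply: integrableS fi => // x [].
have -> : \int[mu]_(x in W) f x = \int[mu]_(x in W `&` T) f x.
  rewrite Rintegral_mkcond [RHS]Rintegral_mkcond; congr (Rintegral _ _ _).
  apply/funext => x; rewrite !patchE.
  have [Wx|Wx] := pselect (W x); have [Tx|Tx] := pselect (T x).
  - by rewrite !mem_set.
  - by rewrite mem_set// memNset ?f0// => -[].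
  - by rewrite !memNset// => -[].
  - by rewrite !memNset// => -[].
have muWT : (mu (W `&` T) <= c%:E)%E.
  by apply: le_trans Tc; apply: le_measure; rewrite ?inE// => x [].
have muWTfin : (mu (W `&` T) < +oo)%E by rewrite (le_lt_trans muWT) ?ltry.
apply: le_trans (le_normr_Rintegral mWT fWT) _.
apply: (@le_trans _ _ (\int[mu]_(x in W `&` T) B)).
  apply: le_Rintegral => //.
  - exact: (integrable_abse fWT).
  - apply/integrableP; split; first exact: measurable_cst.
    under eq_integral do rewrite /= ger0_norm//.
    by rewrite integral_cst// lte_mul_pinfty.
  - by move=> x [Wx Tx]; exact: fB.
rewrite Rintegral_cst// ler_wpM2l//.
have c0 : 0 <= c by rewrite -lee_fin; apply: le_trans Tc.
by rewrite -lee_fin fineK ?ge0_fin_numE.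
Qed.

(* The cutoff gradient is O(m) on a set of measure O(1/m) on which [w] is
   uniformly small, so that its pairing with [w] vanishes in the limit. *)
Lemma mean_gradient0 V w h k : simple_polygon V ->
    mu.-integrable (open_quad V) (EFin \o w) ->
    mu.-integrable (open_quad V) (EFin \o h) ->
    (forall eta, test_function (open_quad V) eta ->
      \int[mu]_(x in open_quad V) (w x * pderiv k eta x) =
      - \int[mu]_(x in open_quad V) (h x * eta x)) ->
    {within quad V, continuous w} -> (forall y, boundary V y -> w y = 0) ->
  \int[mu]_(x in open_quad V) h x = 0.
Proof.
move=> sV wi hi wh cw w0; have mW := measurable_open_quad V.
have [C C0 HC] := quad_cutoffs sV.
have [eta etaP] := choice HC.
have te m : test_function (open_quad V) (eta m) by have [T []] := etaP m.
have mh : measurable_fun (open_quad V : set R2) h.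
  by apply/measurable_EFinP; exact: measurable_int hi.
have lim1 : \int[mu]_(x in open_quad V) (h x * eta m x) @[m --> \oo] -->
    \int[mu]_(x in open_quad V) h x.
  apply: (@cvg_Rintegral_dominated _ _ _ mu _ _ _ (fun x => `|h x|)) => //.
  - move=> m; apply: measurable_funM => //; apply: measurable_funTS.
    by apply: continuous_measurable2; exact: (test_continuous (te m)).
  - move=> x Wx; apply: cvg_near_cst.
    have [e e0 xe] := boundary_dist Wx.1.
    apply: filterS (small_inv C0 e0) => m Hm.
    have [T [_ _ _ nT T1]] := etaP m.
    have nTx : ~ T x.
      by move=> /nT[y Vy]; apply/negP; rewrite -ltNge (lt_le_trans Hm)// xe.
    by have [-> _] := T1 x Wx nTx; rewrite mulr1.
  - exact: (integrable_abse hi).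
  - move=> m x _; have [T [_ [e01 _] _ _ _]] := etaP m.
    have /andP[u0 u1] := e01 x.
    by rewrite normrM (ger0_norm u0) ler_piMr.
have lim2 : \int[mu]_(x in open_quad V) (h x * eta m x) @[m --> \oo] --> (0 : R).
  apply/cvgr0Pnorm_le => e e0.
  (* The bound obtained below is d (C (m + 1)) (C / (m + 1)) = d C^2; the added 1 keeps the
     denominator positive. *)
  pose d := e / (C * C + 1).
  have CC : 0 < C * C + 1 by rewrite ltr_wpDl// mulr_ge0.
  have d0 : 0 < d by rewrite divr_gt0.
  have [r r0 rw] := boundary_small cw w0 d0.
  apply: filterS (small_inv C0 r0) => m Hm.
  have [T [_ [_ eB] [mT muT] nT T1]] := etaP m.
  rewrite -normrN -wh//.
  have m0 : (0 : R) < m.+1%:R by rewrite ltr0n.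
  apply: (@le_trans _ _ ((d * (C * m.+1%:R)) * (C / m.+1%:R))).
    apply: (norm_Rintegral_le (T := T)) => //.
    - exact: (integrable_test_pderiv k mW wi (te m)).
    - by rewrite mulr_ge0 ?(ltW d0)// mulr_ge0.
    - by move=> x Wx /(T1 x Wx)[_ ->]; rewrite mulr0.
    - move=> x Wx /nT[y Vy xy]; rewrite normrM ler_pM//.
      by apply: (rw x y) => //; [left|exact: le_lt_trans Hm].
  rewrite (_ : _ * _ = d * (C * C)); last by field; rewrite gt_eqF.
  by rewrite /d mulrAC ler_pdivrMr// ler_wpM2l ?(ltW e0)// lerDl.
exact: (cvg_unique _ lim1 lim2).
Qed.

End MeanGradient.

(** * Weak gradients of barycentric coordinates *)

Section WeakGradientOfCoordinates.
Context {R : realType}.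
Local Notation R2 := (measurableTypeR R * measurableTypeR R)%type.
Local Notation mu := (lebesgue2 R).
Implicit Types (W : set (R * R)) (u v : R * R -> R) (V : 'I_4 -> R * R).

Lemma weak_gradientP W u : in_H1 W u -> is_weak_gradient W u (weak_gradient W u).
Proof. by move=> [_ exg]; exact: (xgetPex _ exg). Qed.

Lemma weak_gradient_in_L2 W u k : in_H1 W u ->
  in_L2 W (fun x => weak_gradient W u x k 0).
Proof. by move=> /weak_gradientP /(_ k)[]. Qed.

Lemma in_H1_lin W (a b : R) u v : measurable (W : set R2) -> (mu W < +oo)%E ->
  in_H1 W u -> in_H1 W v -> in_H1 W (fun x => a * u x + b * v x).
Proof.
move=> mW Wfin [Lu [g ug]] [Lv [h vh]].
have lin (u' v' : R * R -> R) : in_L2 W u' -> in_L2 W v' ->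
    in_L2 W (fun x => a * u' x + b * v' x).
  by move=> ? ?; apply: in_L2D; exact: in_L2Z.
have Rlin (u' v' w : R * R -> R) :
    mu.-integrable W (EFin \o (fun x => u' x * w x)) ->
    mu.-integrable W (EFin \o (fun x => v' x * w x)) ->
    \int[mu]_(x in W) ((a * u' x + b * v' x) * w x) =
    a * \int[mu]_(x in W) (u' x * w x) + b * \int[mu]_(x in W) (v' x * w x).
  move=> iu iv; under eq_Rintegral do rewrite mulrDl -!mulrA.
  rewrite RintegralD//; last 2 first.
    by have := integrableZl mW a iu.
    by have := integrableZl mW b iv.
  by rewrite !RintegralZl.
have int := in_L2_integrable mW Wfin.
split; first exact: lin.
exists (fun x => a *: g x + b *: h x) => k.
have [Lg gE] := ug k; have [Lh hE] := vh k.
have E x : (a *: g x + b *: h x) k 0 = a * g x k 0 + b * h x k 0 by rewrite !mxE.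
split=> [|eta te]; first by under eq_fun do rewrite E; exact: lin.
under [X in - X]eq_Rintegral do rewrite E.
rewrite !Rlin ?gE ?hE//.
- by rewrite !mulrN -opprD.
- exact: (integrable_test mW (int _ Lg) te).
- exact: (integrable_test mW (int _ Lh) te).
- exact: (integrable_test_pderiv k mW (int _ Lu) te).
- exact: (integrable_test_pderiv k mW (int _ Lv) te).
Qed.

(** The two sides have the same integral against every test function, by the weak formulations for u
    and v and by parts for the affine term; uniqueness then identifies the chosen
    representatives. *)
Lemma weak_gradient_affine V u v (al be ga c : R) k : simple_polygon V ->
    in_H1 (open_quad V) u -> in_H1 (open_quad V) v ->
    (forall x, open_quad V x -> u x = aff al be ga x + c * v x) ->
  {ae mu, forall x, open_quad V x -> weak_gradient (open_quad V) u x k 0 =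
    (al * (basis_vec k).1 + be * (basis_vec k).2) +
    c * weak_gradient (open_quad V) v x k 0}.
Proof.
move=> sV Hu Hv uE; set W := open_quad V; set q := (_ + be * _).
have mW : measurable (W : set R2) := measurable_open_quad V.
have Wfin : (mu W < +oo)%E := lebesgue2_open_quad V.
have int := in_L2_integrable mW Wfin.
have [Lgu guE] := weak_gradientP Hu k; have [Lgv gvE] := weak_gradientP Hv k.
set gu := (fun x => weak_gradient W u x k 0) in Lgu.
set gv := (fun x => weak_gradient W v x k 0) in Lgv.
have i1 : mu.-integrable W (EFin \o (fun=> q : R)).
  apply/integrableP; split; first exact: measurable_cst.
  under eq_integral do rewrite /=.
  by rewrite integral_cst// lte_mul_pinfty.
have i2 := int _ Lgu; have i3 := int _ Lgv.
have i4 : mu.-integrable W (EFin \o (fun x => q + c * gv x)).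
  by have := integrableD mW i1 (integrableZl mW c i3).
have i5 : mu.-integrable W (EFin \o (fun x => gu x - (q + c * gv x))).
  by have := integrableB mW i2 i4.
have ae0 : {ae mu, forall x, W x -> gu x - (q + c * gv x) = 0}.
  apply: open_quad_ae0 => // eta te.
  have ie1 := integrable_test mW i1 te; have ie2 := integrable_test mW i2 te.
  have ie3 := integrable_test mW i3 te; have ie4 := integrable_test mW i4 te.
  have [Lu _] := Hu; have [Lv _] := Hv.
  have iu := integrable_test_pderiv k mW (int _ Lu) te.
  have iv := integrable_test_pderiv k mW (int _ Lv) te.
  under eq_Rintegral do rewrite mulrBl.
  rewrite RintegralB//.
  have ie0 : mu.-integrable W (EFin \o eta).
    have iT : mu.-integrable W (EFin \o (fun=> 1 : R)).
      apply/integrableP; split; first exact: measurable_cst.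
      under eq_integral do rewrite /=.
      by rewrite integral_cst// lte_mul_pinfty.
    have := integrable_test mW iT te; apply: eq_integrable => // x _ /=.
    by rewrite mul1r.
  have -> : \int[mu]_(x in W) ((q + c * gv x) * eta x) =
      q * \int[mu]_(x in W) eta x + c * \int[mu]_(x in W) (gv x * eta x).
    under eq_Rintegral do rewrite mulrDl -mulrA.
    rewrite RintegralD//; last by have := integrableZl mW c ie3.
    by rewrite !RintegralZl.
  have guI := guE eta te; have gvI := gvE eta te.
  rewrite -/gu in guI; rewrite -/gv in gvI.
  have -> : \int[mu]_(x in W) (gu x * eta x) =
      - \int[mu]_(x in W) (u x * pderiv k eta x) by rewrite guI opprK.
  have -> : \int[mu]_(x in W) (gv x * eta x) =
      - \int[mu]_(x in W) (v x * pderiv k eta x) by rewrite gvI opprK.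
  have abp := aff_by_parts al be ga k mW Wfin te.
  have -> : \int[mu]_(x in W) (u x * pderiv k eta x) =
     \int[mu]_(x in W) (aff al be ga x * pderiv k eta x) +
     c * \int[mu]_(x in W) (v x * pderiv k eta x).
    rewrite -RintegralZl// -RintegralD//.
    - by apply: eq_Rintegral => x; rewrite inE => /uE ->; rewrite mulrDl mulrA.
    - have icv := integrableZl mW c iv.
      have := integrableB mW iu icv; apply: eq_integrable => // x; rewrite inE => /uE ux.
      by apply: (congr1 EFin); rewrite /= ux; ring.
    - by have := integrableZl mW c iv.
  by rewrite abp -/q; ring.
apply: (@filterS _ _ (ae_filter_ringOfSetsType mu) _ _ _ ae0) => x gx Wx.
by apply/eqP; rewrite -subr_eq0; apply/eqP; exact: gx.
Qed.

Lemma in_H1_Psi V (phi : 'I_4 -> R * R -> R) :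
  (forall i, in_H1 (open_quad V) (phi i)) -> in_H1 (open_quad V) (Psi phi).
Proof.
move=> Hphi; set W := open_quad V.
have mW : measurable (W : set R2) := measurable_open_quad V.
have Wfin : (mu W < +oo)%E := lebesgue2_open_quad V.
have lin u v (a b : R) := @in_H1_lin W a b u v mW Wfin.
have H01 := lin _ _ (- 2^-1) 2^-1 (Hphi 0) (Hphi 1).
have H23 := lin _ _ (- 2^-1) 2^-1 (Hphi 2%:R) (Hphi 3%:R).
have := lin _ _ 1 1 H01 H23; rewrite (_ : (fun x => _) = Psi phi)//.
by apply/funext => x; rewrite /Psi; ring.
Qed.

(** On an edge a coordinate is affine with prescribed end values, hence the same for all systems. *)
Lemma barycentric_boundary V (phi psi : 'I_4 -> R * R -> R) i x :
  barycentric V phi -> barycentric V psi -> boundary V x -> phi i x = psi i x.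
Proof.
move=> bphi bpsi [j _ [t t01 <-]].
rewrite (bary_edge bphi)// (bary_edge bpsi)//.
by rewrite !(bary_vertex bphi) !(bary_vertex bpsi).
Qed.

Lemma mean_gradient_Psi V (phi psi : 'I_4 -> R * R -> R) k : simple_polygon V ->
    barycentric V phi -> barycentric V psi ->
  \int[mu]_(x in open_quad V) weak_gradient (open_quad V) (Psi phi) x k 0 =
  \int[mu]_(x in open_quad V) weak_gradient (open_quad V) (Psi psi) x k 0.
Proof.
move=> sV bphi bpsi; set W := open_quad V.
have mW : measurable (W : set R2) := measurable_open_quad V.
have Wfin : (mu W < +oo)%E := lebesgue2_open_quad V.
have int := in_L2_integrable mW Wfin.
have H1 : in_H1 W (Psi phi) := in_H1_Psi (bary_H1 bphi).
have H2 : in_H1 W (Psi psi) := in_H1_Psi (bary_H1 bpsi).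
have [L1 E1] := weak_gradientP H1 k; have [L2 E2] := weak_gradientP H2 k.
have i1 := int _ L1; have i2 := int _ L2.
have [/int j1 _] := H1; have [/int j2 _] := H2.
apply/eqP; rewrite -subr_eq0 -RintegralB//; apply/eqP.
apply: (@mean_gradient0 _ V (fun x => Psi phi x - Psi psi x) _ k) => //.
- by have := integrableB mW j1 j2.
- by have := integrableB mW i1 i2.
- move=> eta te.
  under eq_Rintegral do rewrite mulrBl.
  under [X in - X]eq_Rintegral do rewrite mulrBl.
  rewrite !RintegralB//.
  + by rewrite E1// E2// opprB opprK addrC.
  + exact: (integrable_test mW i1 te).
  + exact: (integrable_test mW i2 te).
  + exact: (integrable_test_pderiv k mW j1 te).
  + exact: (integrable_test_pderiv k mW j2 te).
- have cPsi (f : 'I_4 -> R * R -> R) : barycentric V f ->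
      {within quad V, continuous (Psi f)}.
    move=> bf.
    have c i : {within quad V, continuous (f i)} by exact: (bary_continuous bf).
    move=> x; apply: cvgM; first exact: cvg_cst.
    apply: cvgD; last exact: c.
    apply: cvgB; last exact: c.
    by apply: cvgD; [apply: cvgN|]; exact: c.
  by move=> x; apply: cvgB; exact: cPsi.
- move=> y Vy; rewrite /Psi !(barycentric_boundary _ bphi bpsi Vy).
  by rewrite subrr.
Qed.

End WeakGradientOfCoordinates.

(** * The stiffness matrix *)

Section ShapeCoefficients.
Context {R : realType}.
Implicit Types (V : 'I_4 -> R * R).

Lemma ord4P (P : 'I_4 -> Prop) : P 0 -> P 1 -> P 2%:R -> P 3%:R -> forall i, P i.
Proof.
move=> P0 P1 P2 P3 [[|[|[|[|//]]]] i].
- by rewrite (_ : Ordinal i = 0)//; exact: val_inj.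
- by rewrite (_ : Ordinal i = 1)//; exact: val_inj.
- by rewrite (_ : Ordinal i = 2%:R)//; exact: val_inj.
- by rewrite (_ : Ordinal i = 3%:R)//; exact: val_inj.
Qed.

Lemma sum_ord4 (F : 'I_4 -> R) :
  \sum_(i < 4) F i = F 0 + F 1 + F 2%:R + F 3%:R.
Proof.
rewrite !big_ord_recl big_ord0 addr0 !addrA.
by congr (_ + F _ + F _ + F _); exact: val_inj.
Qed.

Definition sel4 (a0 a1 a2 a3 : R) (i : 'I_4) : R :=
  if i == 0 then a0 else if i == 1 then a1 else if i == 2%:R then a2 else a3.

(* Twice the signed area of the triangle with vertices [V i], [V j], [V k]. *)
Definition tri V (i j k : 'I_4) : R := cross (V j - V i) (V k - V i).

(* The alternating vector annihilating (1, 1, 1, 1) and the two coordinate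
   vectors of the vertices. *)
Definition annihilator V : 'I_4 -> R :=
  sel4 (tri V 1 2%:R 3%:R) (- tri V 0 2%:R 3%:R)
       (tri V 0 1 3%:R) (- tri V 0 1 2%:R).

(** The coefficients c_i of the decomposition. The factor normalises the vector so that the
    combination defining [Psi], applied to it, gives 1. *)
Definition hourglass V (i : 'I_4) : R :=
  - annihilator V i / (2 * signed_area V).

(** Each diagonal cuts Q into two triangles whose signed areas add up to that of Q; this is the sum
    of both cuts, doubled since [tri] is twice an area. *)
Lemma signed_areaE V : 4 * signed_area V =
  tri V 1 2%:R 3%:R + tri V 0 2%:R 3%:R + tri V 0 1 3%:R + tri V 0 1 2%:R.
Proof.
rewrite /signed_area sum_ord4 /tri /cross/=.
have -> : (1 + 1 : 'I_4) = 2%:R by exact: val_inj.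
have -> : (2%:R + 1 : 'I_4) = 3%:R by exact: val_inj.
have -> : (3%:R + 1 : 'I_4) = 0 by exact: val_inj.
by rewrite add0r; field.
Qed.

(** [PA], [PB], [PC] are the coefficients of the affine form p |-> cross (p - V k) (V l - V k),
    which vanishes on the line through V k and V l. *)
Let PA V (k l : 'I_4) : R := (V l).2 - (V k).2.
Let PB V (k l : 'I_4) : R := (V k).1 - (V l).1.
Let PC V (k l : 'I_4) : R := - cross (V k) (V l).

Lemma shape_coefficients V : 0 < signed_area V ->
  exists al be ga : 'I_4 -> R, forall (f : 'I_4 -> R) (p : R * R),
    \sum_(i < 4) f i = 1 -> \sum_(i < 4) (V i).1 * f i = p.1 ->
    \sum_(i < 4) (V i).2 * f i = p.2 ->
  forall i, f i = aff (al i) (be i) (ga i) p +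
    hourglass V i * (2^-1 * (- f 0 + f 1 - f 2%:R + f 3%:R)).
Proof.
move=> A0; have S0 : 4 * signed_area V != 0 by rewrite mulf_neq0// gt_eqF.
set S := 4 * signed_area V in S0.
(* Cramer's rule for the linear system made of the three relations and the alternating sum, whose
   determinant is S up to sign. Each cofactor is a sum of three line forms, one per pair of vertices
   other than V i. *)
pose co (g : 'I_4 -> 'I_4 -> R) i : R :=
  sel4 (g 3%:R 2%:R + g 3%:R 1 + g 2%:R 1) (g 3%:R 2%:R + g 0 3%:R + g 0 2%:R)
       (g 1 3%:R + g 0 3%:R + g 1 0) (g 2%:R 1 + g 2%:R 0 + g 1 0) i / S.
exists (co (PA V)), (co (PB V)), (co (PC V)) => f p.
rewrite !sum_ord4 => h1 hx hy i.
have f3 : f 3%:R = 1 - f 0 - f 1 - f 2%:R by rewrite -h1; ring.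
apply: (mulfI S0).
have -> q : S * (aff (co (PA V) i) (co (PB V) i) (co (PC V) i) p +
    hourglass V i * (2^-1 * q)) =
    S * co (PA V) i * p.1 + S * co (PB V) i * p.2 + S * co (PC V) i -
    annihilator V i * q.
  rewrite /hourglass /S /aff; field.
  by rewrite gt_eqF.
have coE g : S * co g i =
  sel4 (g 3%:R 2%:R + g 3%:R 1 + g 2%:R 1) (g 3%:R 2%:R + g 0 3%:R + g 0 2%:R)
       (g 1 3%:R + g 0 3%:R + g 1 0) (g 2%:R 1 + g 2%:R 0 + g 1 0) i.
  by rewrite /co mulrC divfK.
(* With f 3 eliminated and p expressed through f, a polynomial identity remains. *)
rewrite !coE /S signed_areaE -hx -hy f3.
move: i {coE}; apply: ord4P;
  rewrite /annihilator /sel4/= /tri /PA /PB /PC /cross/= ?f3; ring.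
Qed.

(** All four triangles have equal area: those sharing a side have their apexes on the parallel
    opposite side, and the two diagonal cuts give the last one. *)
Lemma hourglass_parallelogram V : 0 < signed_area V -> parallelogram V ->
  hourglass V =1 sel4 (- 2^-1) 2^-1 (- 2^-1) 2^-1.
Proof.
move=> A0 pV; have := pV 0; have := pV 1.
have -> : (1 + 1 : 'I_4) = 2%:R by exact: val_inj.
have -> : (1 + 2%:R : 'I_4) = 3%:R by exact: val_inj.
have -> : (1 + 3%:R : 'I_4) = 0 by exact: val_inj.
rewrite !add0r => h1 h0.
have e1 : tri V 1 2%:R 3%:R = tri V 0 1 2%:R.
  apply/eqP; rewrite -subr_eq0 -oppr_eq0 -h1; apply/eqP.
  by rewrite /tri /cross/=; ring.
have e2 : tri V 0 1 3%:R = tri V 0 1 2%:R.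
  apply/eqP; rewrite -subr_eq0 -h0; apply/eqP.
  by rewrite /tri /cross/=; ring.
have e3 : tri V 0 2%:R 3%:R = tri V 0 1 2%:R.
  have : tri V 0 2%:R 3%:R = tri V 1 2%:R 3%:R + tri V 0 1 3%:R - tri V 0 1 2%:R.
    by rewrite /tri /cross/=; ring.
  by rewrite e1 e2 addrK.
have AE : signed_area V = tri V 0 1 2%:R.
  by have := signed_areaE V; rewrite e1 e2 e3; lra.
have T0 : tri V 0 1 2%:R != 0 by rewrite -AE gt_eqF.
by apply: ord4P; rewrite /hourglass AE /annihilator /sel4/= ?e1 ?e2 ?e3; field.
Qed.

End ShapeCoefficients.

(** * Splitting of the energy and independence of the remainder *)

Section Stiffness.
Context {R : realType}.
Local Notation R2 := (measurableTypeR R * measurableTypeR R)%type.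
Local Notation mu := (lebesgue2 R).
Implicit Types (V : 'I_4 -> R * R) (kappa : 'M[R]_2) (phi : 'I_4 -> R * R -> R).

Lemma quadratic_formE kappa (u v : 'cV[R]_2) :
  (v^T *m (kappa *m u)) 0 0 =
  v 0 0 * (kappa 0 0 * u 0 0 + kappa 0 1 * u 1 0) +
  v 1 0 * (kappa 1 0 * u 0 0 + kappa 1 1 * u 1 0).
Proof.
have l1 : lift ord0 ord0 = 1 :> 'I_2 by exact: val_inj.
by rewrite !mxE !big_ord_recl !big_ord0 !mxE !big_ord_recl !big_ord0 !l1 !addr0.
Qed.

(* [l] and [l'] are the gradients of the affine parts of [u] and [v], and [m] is
   the mean of the gradient [H] of [Psi phi]. *)
Lemma energy_split V kappa (u v z : R * R -> R) (l l' m : 'I_2 -> R) (c c' : R) :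
    in_H1 (open_quad V) u -> in_H1 (open_quad V) v -> in_H1 (open_quad V) z ->
    (forall k, {ae mu, forall x, open_quad V x ->
      weak_gradient (open_quad V) u x k 0 =
      l k + c * weak_gradient (open_quad V) z x k 0}) ->
    (forall k, {ae mu, forall x, open_quad V x ->
      weak_gradient (open_quad V) v x k 0 =
      l' k + c' * weak_gradient (open_quad V) z x k 0}) ->
    (forall k, \int[mu]_(x in open_quad V) weak_gradient (open_quad V) z x k 0 =
      m k) ->
  energy V kappa u v =
  (l' 0 * (kappa 0 0 * l 0 + kappa 0 1 * l 1) +
   l' 1 * (kappa 1 0 * l 0 + kappa 1 1 * l 1)) * fine (mu (open_quad V)) +
  (c * (l' 0 * kappa 0 0 + l' 1 * kappa 1 0) +
   c' * (kappa 0 0 * l 0 + kappa 0 1 * l 1)) * m 0 +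
  (c * (l' 0 * kappa 0 1 + l' 1 * kappa 1 1) +
   c' * (kappa 1 0 * l 0 + kappa 1 1 * l 1)) * m 1 +
  c * c' * energy V kappa z z.
Proof.
move=> Hu Hv Hz aeu aev zm; set W := open_quad V.
have mW : measurable (W : set R2) := measurable_open_quad V.
have Wfin : (mu W < +oo)%E := lebesgue2_open_quad V.
set gu := weak_gradient W u; set gv := weak_gradient W v.
set gz := weak_gradient W z.
have Lu k : in_L2 W (fun x => gu x k 0) by exact: weak_gradient_in_L2.
have Lv k : in_L2 W (fun x => gv x k 0) by exact: weak_gradient_in_L2.
have Lz k : in_L2 W (fun x => gz x k 0) by exact: weak_gradient_in_L2.
set a := (l' 0 * _ + l' 1 * _); set b0 := (c * _ + c' * _).
set b1 := (X in _ + X * m 1 + _).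
have meas (g : R * R -> 'cV[R]_2) (h : R * R -> 'cV[R]_2) :
    (forall k, in_L2 W (fun x => g x k 0)) ->
    (forall k, in_L2 W (fun x => h x k 0)) ->
    mu.-integrable W (EFin \o (fun x => ((g x)^T *m (kappa *m h x)) 0 0)).
  move=> Lg Lh.
  have i1 k k' : mu.-integrable W (EFin \o (fun x => g x k 0 * (kappa k k' * h x k' 0))).
    by apply: in_L2_mul => //; exact: in_L2Z.
  have s0 := integrableD mW (i1 0 0) (i1 0 1).
  have s1 := integrableD mW (i1 1 0) (i1 1 1).
  have := integrableD mW s0 s1; apply: eq_integrable => // x _.
  by apply: (congr1 EFin); rewrite quadratic_formE !mulrDr.
have iz k := in_L2_integrable mW Wfin (Lz k).
have ia : mu.-integrable W (EFin \o (fun=> a : R)).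
  apply/integrableP; split; first exact: measurable_cst.
  under eq_integral do rewrite /=.
  by rewrite integral_cst// lte_mul_pinfty.
have ib0 : mu.-integrable W (EFin \o (fun x => b0 * gz x 0 0)).
  by have := integrableZl mW b0 (iz 0).
have ib1 : mu.-integrable W (EFin \o (fun x => b1 * gz x 1 0)).
  by have := integrableZl mW b1 (iz 1).
have izz := meas gz gz Lz Lz.
have ic : mu.-integrable W (EFin \o
    (fun x => c * c' * ((gz x)^T *m (kappa *m gz x)) 0 0)).
  by have := integrableZl mW (c * c') izz.
have iab : mu.-integrable W (EFin \o (fun x => a + b0 * gz x 0 0)).
  by have := integrableD mW ia ib0.
have iabb : mu.-integrable W (EFin \o (fun x => a + b0 * gz x 0 0 + b1 * gz x 1 0)).
  by have := integrableD mW iab ib1.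
have iall : mu.-integrable W (EFin \o (fun x => a + b0 * gz x 0 0 + b1 * gz x 1 0 +
    c * c' * ((gz x)^T *m (kappa *m gz x)) 0 0)).
  by have := integrableD mW iabb ic.
have measR (g : R * R -> R) : mu.-integrable W (EFin \o g) ->
    measurable_fun (W : set R2) g.
  by move=> ig; apply/measurable_EFinP; exact: measurable_int ig.
transitivity (\int[mu]_(x in W) (a + b0 * gz x 0 0 + b1 * gz x 1 0 +
    c * c' * ((gz x)^T *m (kappa *m gz x)) 0 0)).
  apply: ae_eq_Rintegral => //.
  - exact: (measR _ (meas gv gu Lv Lu)).
  - exact: (measR _ iall).
  - have F := ae_filter_ringOfSetsType mu.
    have aeuv := @filterI _ _ F _ _ (@filterI _ _ F _ _ (aeu 0) (aeu 1))
      (@filterI _ _ F _ _ (aev 0) (aev 1)).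
    apply: (@filterS _ _ F _ _ _ aeuv) => x [[u0 u1] [v0 v1]] Wx.
    rewrite !quadratic_formE.
    rewrite [gu x 0 0]u0// [gu x 1 0]u1// [gv x 0 0]v0// [gv x 1 0]v1//.
    by rewrite -/W -/gz /a /b0 /b1; ring.
rewrite RintegralD// RintegralD// RintegralD// Rintegral_cst//.
by rewrite RintegralZl// RintegralZl// RintegralZl// !zm.
Qed.

Definition hourglass_matrix V : 'M[R]_4 := \matrix_(i, j) (hourglass V i * hourglass V j).

Lemma hourglass_matrixE V i j :
  hourglass_matrix V i j = hourglass V i * hourglass V j.
Proof. by rewrite mxE. Qed.

Lemma stiffnessE V kappa phi i j :
  stiffness V kappa phi i j = energy V kappa (phi j) (phi i).
Proof. by rewrite mxE. Qed.

Lemma stiffness_remainder V kappa phi psi : is_quadrilateral V ->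
    barycentric V phi -> barycentric V psi ->
  stiffness V kappa phi - tau V kappa phi *: hourglass_matrix V =
  stiffness V kappa psi - tau V kappa psi *: hourglass_matrix V.
Proof.
move=> [sV A0]; have [al [be [ga shape]]] := shape_coefficients A0.
pose l i (k : 'I_2) := al i * (basis_vec k).1 + be i * (basis_vec k).2 : R.
have grad f i k : barycentric V f -> {ae mu, forall x, open_quad V x ->
      weak_gradient (open_quad V) (f i) x k 0 =
      l i k + hourglass V i * weak_gradient (open_quad V) (Psi f) x k 0}.
  move=> bf; apply: (@weak_gradient_affine _ _ _ _ _ _ (ga i)) => //.
  - exact: (bary_H1 bf).
  - exact: in_H1_Psi (bary_H1 bf).
  - move=> x Wx; apply: (shape (f ^~ x)).
    + by apply: (bary_sum bf); left.
    + by apply: (bary_x bf); left.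
    + by apply: (bary_y bf); left.
move=> bphi bpsi.
(* The mean gradient inserted here is that of [Psi psi] whichever system f is; the right-hand sides
   for phi and psi then differ only in the energy of [Psi f]. *)
have main f i j (bf : barycentric V f) := energy_split kappa
  (bary_H1 bf j) (bary_H1 bf i) (in_H1_Psi (bary_H1 bf))
  (fun k => grad f j k bf) (fun k => grad f i k bf)
  (fun k => mean_gradient_Psi k sV bf bpsi).
apply/matrixP => i j.
have entry (X M : 'M[R]_4) (t : R) : (X - t *: M) i j = X i j - t * M i j.
  by rewrite !mxE.
have E f : (stiffness V kappa f - tau V kappa f *: hourglass_matrix V) i j =
    energy V kappa (f j) (f i) -
    energy V kappa (Psi f) (Psi f) * (hourglass V i * hourglass V j).
  exact: (etrans (entry _ _ _) (congr2 (fun a b => a - tau V kappa f * b)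
    (stiffnessE V kappa f i j) (hourglass_matrixE V i j))).
have cancel (a e h : R) : a + h * e - e * h = a by ring.
(* [energy_split] yields the product c_j c_i, and commutativity matches it with the entry c_i c_j,
   so that the energy of [Psi f] cancels. *)
have E' f (bf : barycentric V f) := etrans (E f) (etrans
  (congr1 (fun a => a - _ * _) (etrans (main f i j bf)
    (congr1 (fun h => _ + h * _) (mulrC _ _))))
  (cancel _ _ _)).
exact: (etrans (E' _ bphi) (esym (E' _ bpsi))).
Qed.

End Stiffness.

Theorem theorem1 (R : realType) :
  exists (A : ('I_4 -> R * R) -> 'M[R]_2 -> 'M[R]_4)
         (B : ('I_4 -> R * R) -> 'M[R]_4),
    (forall (V : 'I_4 -> R * R) (kappa : 'M[R]_2) (phi : 'I_4 -> R * R -> R),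
        is_quadrilateral V -> spd kappa -> barycentric V phi ->
        stiffness V kappa phi = A V kappa + tau V kappa phi *: B V) /\
    (forall V V' : 'I_4 -> R * R,
        is_quadrilateral V -> is_quadrilateral V' ->
        parallelogram V -> parallelogram V' -> B V = B V').
Proof.
pose remainder V kappa phi : 'M[R]_4 :=
  stiffness V kappa phi - tau V kappa phi *: hourglass_matrix V.
(* A is the remainder of any system of coordinates on Q, with default 0 if there is none; by
   [stiffness_remainder] the choice does not matter on a quadrilateral. *)
exists (fun V kappa =>
  xget 0 [set X | exists2 psi, barycentric V psi & X = remainder V kappa psi]).
exists (@hourglass_matrix R); split=> [V kappa phi qV _ bphi|V V' qV qV' pV pV'].
  have [] := @xgetPex _ (0 : 'M[R]_4) [set X | exists2 psi,
    barycentric V psi & X = remainder V kappa psi].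
    by exists (remainder V kappa phi), phi.
  move=> psi bpsi ->; rewrite /remainder.
  by rewrite -(stiffness_remainder kappa qV bphi bpsi) subrK.
apply/matrixP => i j; rewrite !hourglass_matrixE.
rewrite !(hourglass_parallelogram qV.2 pV).
by rewrite !(hourglass_parallelogram qV'.2 pV').
Qed.
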